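(* Every rank-$n$ object $E$ of the proalgebraic vector-bundle category $\operatorname{Vect}^{\mathrm{proalg}}(\mathbb{C}P^1_{\mathbb{Q}})$ admits a splitting $$E\cong\mathcal{O}_{\mathbb{C}P^1_{\mathbb{Q}}}(q_1)\oplus\cdots\oplus\mathcal{O}_{\mathbb{C}P^1_{\mathbb{Q}}}(q_n),\qquad q_i\in\mathbb{Q}.$$ The unordered rational $n$-tuple $\{q_1,\ldots,q_n\}$ is uniquely determined by $E$.
   Context: For each positive integer $N$ let $\mathbb{P}^1_N$ be a copy of the complex projective line, and for $N\mid M$ let $\rho_{M,N}:\mathbb{P}^1_M\to\mathbb{P}^1_N$ be $z_N=z_M^{M/N}$. The adelic projective line is $\mathbb{C}P^1_{\mathbb{Q}}=\varprojlim\mathbb{P}^1_N$, with projections $p_N:\mathbb{C}P^1_{\mathbb{Q}}\to\mathbb{P}^1_N$. The proalgebraic vector-bundle category is the colimit $$\operatorname{Vect}^{\mathrm{proalg}}(\mathbb{C}P^1_{\mathbb{Q}}):=\varinjlim_N\operatorname{Vect}(\mathbb{P}^1_N)$$ over positive integers ordered by divisibility, where $\operatorname{Vect}(\mathbb{P}^1_N)$ is the category of finite-rank algebraic vector bundles on $\mathbb{P}^1_N$ and the transition functors are the pullbacks $\rho_{M,N}^*$. Thus an object is represented by an algebraic vector bundle on one $\mathbb{P}^1_N$, with two representatives identified after pullback to a common refinement. For $q=k/N\in\mathbb{Q}$ define $\mathcal{O}_{\mathbb{C}P^1_{\mathbb{Q}}}(q):=p_N^*\mathcal{O}_{\mathbb{P}^1_N}(k)$,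 i.e. the object represented by $\mathcal{O}_{\mathbb{P}^1_N}(k)$; this is well defined because $\rho_{M,N}^*\mathcal{O}_{\mathbb{P}^1_N}(k)\cong\mathcal{O}_{\mathbb{P}^1_M}(kM/N)$. *)

(* Defs.v *)
From HB Require Import structures.
From mathcomp Require Import all_boot all_order all_algebra.
From mathcomp Require Import boolp classical_sets cardinality reals complex.

Set Implicit Arguments.
Unset Strict Implicit.
Unset Printing Implicit Defensive.
Import Order.TTheory GRing.Theory Num.Theory.
Local Open Scope classical_set_scope.
Local Open Scope ring_scope.

(* Varieties are classical: spaces of closed points over an algebraically
   closed field, with the Zariski topology. *)

(* [Some a] is the point of affine coordinate z = a, i.e. [a : 1], and [None]
   is the point at infinity [1 : 0]. *)
Definition P1 (F : closedFieldType) : Type := option F.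

Section ProjectiveLine.
Variable F : closedFieldType.
Implicit Types (U V W : set (P1 F)) (f g : P1 F -> F).

(* A proper Zariski closed subset of a curve is finite. *)
Definition zopen U : Prop := U = set0 \/ finite_set (~` U).

(* For [size p <= d.+1], the value at [a : 1], resp. [1 : 0], of the binary
   form of degree d whose dehomogenization is p. *)
Definition form_val (d : nat) (p : {poly F}) (x : P1 F) : F :=
  if x is Some a then p.[a] else p`_d.

(* f is regular at x, as a function on U, if near x it is a quotient of two
   forms of the same degree with nowhere vanishing denominator. *)
Definition regular_at U f (x : P1 F) : Prop :=
  exists V (d : nat) (p q : {poly F}),
    [/\ zopen V, V x, V `<=` U, (size p <= d.+1)%N /\ (size q <= d.+1)%N &
        forall y, V y ->
          form_val d q y != 0 /\ f y = form_val d p y / form_val d q y].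

Definition regular_on U f : Prop := forall x, U x -> regular_at U f x.

Definition regular_mx (m n : nat) U (G : P1 F -> 'M[F]_(m, n)) : Prop :=
  forall k l, regular_on U (fun x => G x k l).

Lemma zopenT : zopen setT.
Proof. by right; rewrite setCT; exact: finite_set0. Qed.

Lemma zopenI U V : zopen U -> zopen V -> zopen (U `&` V).
Proof.
move=> [->|fU]; first by move=> _; left; rewrite set0I.
move=> [->|fV]; first by left; rewrite setI0.
by right; rewrite setCI finite_setU.
Qed.

Lemma regular_at_loc U W f g x : zopen W -> W x -> W `<=` U ->
  regular_at W f x -> (forall y, W y -> f y = g y) -> regular_at U g x.
Proof.
move=> oW Wx WU [V [d [p [q [oV Vx VW sz H]]]]] E.
exists V, d, p, q; split => //; first exact: subset_trans WU.
by move=> y Vy; rewrite -E; [exact: H | exact: VW].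
Qed.

Lemma regular_at_sub U W f x : zopen W -> W x ->
  regular_at U f x -> regular_at (U `&` W) f x.
Proof.
move=> oW Wx [V [d [p [q [oV Vx VW sz H]]]]].
exists (V `&` W), d, p, q; split => //; first exact: zopenI.
- by move=> y [/VW Uy Wy].
- by move=> y [Vy _]; exact: H.
Qed.

Lemma regular_at_cst U (c : F) x : zopen U -> U x ->
  regular_at U (fun=> c) x.
Proof.
move=> oU Ux; exists U, 0%N, c%:P, 1; split => //.
  by rewrite size_polyC size_poly1; case: (c != 0).
move=> y _; case: y => [a|] /=; rewrite ?hornerC ?coefC ?coef1 /=;
  by rewrite ?oner_neq0 divr1.
Qed.

Lemma form_valM d e (p q : {poly F}) y :
  (size p <= d.+1)%N -> (size q <= e.+1)%N ->
  form_val (d + e) (p * q) y = form_val d p y * form_val e q y.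
Proof.
move=> sp sq; case: y => [a|] /=; first by rewrite hornerM.
have de : (d < (d + e).+1)%N by rewrite ltnS leq_addr.
rewrite coefM (bigD1 (Ordinal de)) //= addKn big1 ?addr0 // => -[i /= ile] ne.
have {}ne : i != d by apply: contra ne => /eqP ?; apply/eqP/val_inj.
case: (ltngtP i d) ne => // id _.
  rewrite [q`_ _]nth_default ?mulr0 //; apply: (leq_trans sq).
  by rewrite ltn_subRL addnC [(d + e)%N]addnC ltn_add2l.
by rewrite nth_default ?mul0r //; apply: (leq_trans sp).
Qed.

Lemma form_valD d (p q : {poly F}) y :
  form_val d (p + q) y = form_val d p y + form_val d q y.
Proof. by case: y => [a|] /=; rewrite ?hornerD ?coefD. Qed.

Lemma size_formM d e (p q : {poly F}) :
  (size p <= d.+1)%N -> (size q <= e.+1)%N -> (size (p * q)%R <= (d + e).+1)%N.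
Proof.
move=> sp sq; apply: (leq_trans (size_polyMleq p q)).
have := leq_add sp sq; rewrite addSn addnS -[(d + e).+2]/((d + e).+1.+1).
by case: (size p + size q)%N.
Qed.

Lemma regular_at_mul U f g x : regular_at U f x -> regular_at U g x ->
  regular_at U (fun y => f y * g y) x.
Proof.
move=> [V [d [p [q [oV Vx VU [sp sq] H]]]]]
  [V' [d' [p' [q' [oV' V'x VU' [sp' sq'] H']]]]].
exists (V `&` V'), (d + d')%N, (p * p'), (q * q'); split => //.
- exact: zopenI.
- by move=> y [/VU].
- by split; exact: size_formM.
- move=> y [/H [n0 ->] /H' [n0' ->]]; rewrite !form_valM //; split.
    by rewrite mulf_neq0.
  by rewrite mulf_div.
Qed.

Lemma regular_at_add U f g x : regular_at U f x -> regular_at U g x ->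
  regular_at U (fun y => f y + g y) x.
Proof.
move=> [V [d [p [q [oV Vx VU [sp sq] H]]]]]
  [V' [d' [p' [q' [oV' V'x VU' [sp' sq'] H']]]]].
exists (V `&` V'), (d + d')%N, (p * q' + q * p'), (q * q'); split => //.
- exact: zopenI.
- by move=> y [/VU].
- split; last exact: size_formM.
  by apply: (leq_trans (size_polyD _ _)); rewrite geq_max !size_formM.
- move=> y [/H [n0 ->] /H' [n0' ->]]; rewrite form_valD !form_valM //; split.
    by rewrite mulf_neq0.
  by rewrite addf_div // [form_val d q y * _]mulrC.
Qed.

Lemma regular_at_sum U (n : nat) (h : 'I_n -> P1 F -> F) x : zopen U -> U x ->
  (forall i, regular_at U (h i) x) ->
  regular_at U (fun y => \sum_(i < n) h i y) x.
Proof.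
move=> oU Ux; elim: n h => [|n IH] h H.
  by apply: (@regular_at_loc U U (fun=> 0)) => //;
    [exact: regular_at_cst | move=> y _; rewrite big_ord0].
apply: (@regular_at_loc U U
  (fun y => h ord0 y + \sum_(i < n) h (lift ord0 i) y)) => //.
  apply: regular_at_add; first exact: H.
  exact: IH (fun i => h (lift ord0 i)) (fun i => H (lift ord0 i)).
by move=> y _; rewrite big_ord_recl.
Qed.

Record P1_morphism := P1Morphism {
  mor_fun :> P1 F -> P1 F;
  mor_cont : forall U, zopen U -> zopen (mor_fun @^-1` U);
  mor_reg : forall U f, zopen U -> regular_on U f ->
    regular_on (mor_fun @^-1` U) (f \o mor_fun)
}.

(* At infinity z ^ d is infinity for 0 < d; for d = 0 the map is constant. *)
Definition pow_fun (d : nat) (x : P1 F) : P1 F :=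
  if x is Some a then Some (a ^+ d) else if d == 0%N then Some 1 else None.

Lemma pow_fun0 x : pow_fun 0 x = Some 1.
Proof. by case: x => [a|] //=; rewrite expr0. Qed.

Lemma pow_cont d U : zopen U -> zopen (pow_fun d @^-1` U).
Proof.
case: d => [|d].
  have [U1|U1] := pselect (U (Some 1)) => _.
    right; rewrite (_ : ~` _ = set0); first exact: finite_set0.
    by apply/seteqP; split => x //=; rewrite pow_fun0.
  by left; apply/seteqP; split => x //=; rewrite pow_fun0.
move=> [->|fU]; first by left; rewrite preimage_set0.
right; have -> : ~` (pow_fun d.+1 @^-1` U) =
    \bigcup_(y in ~` U) (pow_fun d.+1 @^-1` [set y]).
  apply/seteqP; split => x; first by move=> Ux; exists (pow_fun d.+1 x).
  by move=> [y Uy xy]; rewrite /setC /preimage /mkset xy.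
apply: bigcup_finite => // -[a|] _; last first.
  apply: (@sub_finite_set _ _ [set None]); last exact: finite_set1.
  by case.
have p0 : 'X^(d.+1) - a%:P != 0 :> {poly F}.
  by rewrite -size_poly_eq0 size_XnsubC.
have [s E] := closed_field_poly_normal ('X^(d.+1) - a%:P : {poly F}).
apply: (@sub_finite_set _ _ (Some @` [set` s])); last first.
  by apply: finite_image; exact: finite_seq.
move=> [b|] //= [ba]; exists b => //=.
have : root ('X^(d.+1) - a%:P) b by rewrite /root !hornerE ba subrr.
rewrite E rootZ ?root_prod_XsubC //.
by rewrite lead_coef_eq0.
Qed.

Lemma form_val_pow d e (p : {poly F}) x : (0 < d)%N ->
  form_val (e * d) (p \Po 'X^d) x = form_val e p (pow_fun d x).
Proof.
case: d => // d _; case: x => [a|] /=; first by rewrite horner_comp hornerXn.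
by rewrite coef_comp_poly_Xn // dvdn_mull // mulnK.
Qed.

Lemma size_form_pow d e (p : {poly F}) : (size p <= e.+1)%N ->
  (size (p \Po 'X^d)%R <= (e * d).+1)%N.
Proof.
move=> sp; apply: (leq_trans (size_comp_poly_leq _ _)).
rewrite ltnS size_polyXn /= leq_mul2r; apply/orP; right.
by case: (size p) sp.
Qed.

Lemma pow_reg d U f : zopen U -> regular_on U f ->
  regular_on (pow_fun d @^-1` U) (f \o pow_fun d).
Proof.
move=> oU rf x /=; case: d => [|d] Ux.
  apply: (@regular_at_loc _ (pow_fun 0 @^-1` U) (fun=> f (Some 1))) => //.
  - exact: pow_cont.
  - by apply: regular_at_cst => //; exact: pow_cont.
  - by move=> y _; rewrite /= pow_fun0.
have [V [e [p [q [oV Vx VU [sp sq] H]]]]] := rf _ Ux.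
exists (pow_fun d.+1 @^-1` V), (e * d.+1)%N, (p \Po 'X^(d.+1)), (q \Po 'X^(d.+1)).
split => //.
- exact: pow_cont.
- by move=> y /VU.
- by split; exact: size_form_pow.
- by move=> y /H; rewrite !form_val_pow.
Qed.

Definition pow_morphism (d : nat) : P1_morphism :=
  P1Morphism (@pow_cont d) (@pow_reg d).

(* The transition map P1_M -> P1_N, z_N = z_M ^ (M / N), for N %| M. *)
Definition rho (M N : nat) : P1_morphism := pow_morphism (M %/ N)%N.

Lemma rho_comp (N M L : nat) x : (0 < N)%N -> (0 < M)%N ->
  (N %| M)%N -> (M %| L)%N -> rho M N (rho L M x) = rho L N x.
Proof.
move=> N0 M0 /dvdnP[a Ea] /dvdnP[b ->]; rewrite {}Ea in M0 *.
have a0 : (0 < a)%N by move: M0; rewrite muln_gt0 => /andP[].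
rewrite /rho /= !mulnK // mulnA mulnK //.
case: x => [c|] /=; first by rewrite -exprM.
by case: a a0 {M0} => // a _; case: b => [|b] //=; rewrite expr1n.
Qed.

End ProjectiveLine.

(* A family of vector spaces over P1 with a Zariski atlas of linear
   trivializations whose transition matrices are regular.  P1 is connected, so
   a bundle of finite rank has constant rank.  Coordinates are row vectors. *)
Record bundle (F : closedFieldType) := Bundle {
  rank : nat;
  fib : P1 F -> lmodType F;
  chart : Type;
  dom : chart -> set (P1 F);
  triv : forall (i : chart) (x : P1 F), fib x -> 'rV[F]_rank;
  dom_open : forall i, zopen (dom i);
  dom_cover : forall x, exists i, dom i x;
  triv_linear : forall i x, dom i x -> linear (triv i (x := x));
  triv_bij : forall i x, dom i x -> bijective (triv i (x := x));
  triv_trans : forall i j, exists2 G : P1 F -> 'M[F]_rank,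
    regular_mx (dom i `&` dom j) G &
    forall x (v : fib x), dom i x -> dom j x -> triv j v = triv i v *m G x
}.

Record bundle_hom (F : closedFieldType) (A B : bundle F) := BundleHom {
  hom_map : forall x, fib A x -> fib B x;
  hom_linear : forall x, linear (hom_map (x := x));
  hom_reg : forall i j, exists2 G : P1 F -> 'M[F]_(rank A, rank B),
    regular_mx (dom (b := A) i `&` dom (b := B) j) G &
    forall x (v : fib A x), dom i x -> dom j x ->
      triv j (hom_map v) = triv i v *m G x
}.

Definition hom_eq (F : closedFieldType) (A B : bundle F)
    (h k : bundle_hom A B) : Prop :=
  forall x (v : fib A x), hom_map h v = hom_map k v.

Section BundleConstructions.
Variable F : closedFieldType.
Implicit Types A B C : bundle F.
Local Obligation Tactic := idtac.

Program Definition hom_id A : bundle_hom A A :=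
  @BundleHom F A A (fun x v => v) _ _.
Next Obligation. by []. Qed.
Next Obligation. exact: triv_trans. Qed.

Lemma triv_mx_inj A (i : chart A) x (m : nat) (M N : 'M[F]_(rank A, m)) :
  dom i x -> (forall v : fib A x, triv i v *m M = triv i v *m N) -> M = N.
Proof.
move=> ix H; have [g _ gK] := triv_bij ix.
by apply/row_matrixP => k; rewrite !rowE -(gK (delta_mx 0 k)) H.
Qed.

Lemma regular_at_mulmx (U : set (P1 F)) (m n p : nat) (G : P1 F -> 'M[F]_(m, n))
    (H : P1 F -> 'M[F]_(n, p)) x k l : zopen U -> U x ->
  (forall r s, regular_at U (fun y => G y r s) x) ->
  (forall r s, regular_at U (fun y => H y r s) x) ->
  regular_at U (fun y => (G y *m H y) k l) x.
Proof.
move=> oU Ux rG rH.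
apply: (@regular_at_loc _ U U (fun y => \sum_(r < n) G y k r * H y r l)) => //.
  by apply: regular_at_sum => // r; exact: regular_at_mul.
by move=> y _; rewrite mxE.
Qed.

Lemma hom_comp_reg A B C (h : bundle_hom A B) (k : bundle_hom B C) i j :
  exists2 G : P1 F -> 'M[F]_(rank A, rank C),
    regular_mx (dom (b := A) i `&` dom (b := C) j) G &
    forall x (v : fib A x), dom i x -> dom j x ->
      triv j (hom_map k (hom_map h v)) = triv i v *m G x.
Proof.
have /choice[c cP] := @dom_cover F B.
have /choice[G GP] : forall b, exists G, regular_mx (dom i `&` dom b) G /\
    forall x (v : fib A x), dom i x -> dom b x ->
      triv b (hom_map h v) = triv i v *m G x.
  by move=> b; have [G ? ?] := @hom_reg _ _ _ h i b; exists G.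
have /choice[H HP] : forall b, exists H, regular_mx (dom b `&` dom j) H /\
    forall x (v : fib B x), dom b x -> dom j x ->
      triv j (hom_map k v) = triv b v *m H x.
  by move=> b; have [H ? ?] := @hom_reg _ _ _ k b j; exists H.
have GH b x (v : fib A x) : dom i x -> dom b x -> dom j x ->
    triv j (hom_map k (hom_map h v)) = triv i v *m (G b x *m H b x).
  by move=> ix bx jx; rewrite (HP b).2 // (GP b).2 // mulmxA.
exists (fun x => G (c x) x *m H (c x) x); last first.
  by move=> x v ix jx; exact: GH.
move=> r s x [ix jx]; pose b := c x; pose W := dom i `&` dom j `&` dom b.
have bx : dom b x by exact: cP.
have oW : zopen W.
  by do 2?[apply: zopenI]; exact: dom_open.
have Wx : W x by [].
apply: (@regular_at_loc _ _ W (fun y => (G b y *m H b y) r s)) => //.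
- by move=> y [].
- apply: regular_at_mulmx => // r' s'.
  + apply: (@regular_at_loc _ _ W (fun y => G b y r' s')) => //.
    rewrite /W setIAC; apply: regular_at_sub => //; first exact: dom_open.
    exact: (GP b).1.
  + apply: (@regular_at_loc _ _ W (fun y => H b y r' s')) => //.
    rewrite /W -setIA setIC [dom j `&` _]setIC.
    apply: regular_at_sub => //; first exact: dom_open.
    exact: (HP b).1.
- move=> y [[iy jy] b_y]; congr fun_of_matrix.
  apply: (triv_mx_inj iy) => v; rewrite -!GH //; exact: cP.
Qed.

Program Definition hom_comp A B C (h : bundle_hom A B) (k : bundle_hom B C) :
    bundle_hom A C :=
  @BundleHom F A C (fun x v => hom_map k (hom_map h v)) _ (hom_comp_reg h k).
Next Obligation.
by move=> A B C h k x a u v; rewrite !hom_linear.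
Qed.

Program Definition pullback (f : P1_morphism F) A : bundle F :=
  @Bundle F (rank A) (fun x => fib A (f x)) (chart A)
    (fun i => f @^-1` dom i) (fun i x => triv i (x := f x)) _ _ _ _ _.
Next Obligation. by move=> f A i; apply: mor_cont; exact: dom_open. Qed.
Next Obligation. by move=> f A x; exact: dom_cover. Qed.
Next Obligation. by move=> f A i x; exact: triv_linear. Qed.
Next Obligation. by move=> f A i x; exact: triv_bij. Qed.
Next Obligation.
move=> f A i j; have [G rG GP] := @triv_trans _ A i j.
exists (G \o f); last by move=> x v ix jx; exact: GP.
move=> k l; rewrite -preimage_setI.
apply: (mor_reg (f := fun y => G y k l)) => //.
by apply: zopenI; exact: dom_open.
Qed.

Program Definition hom_pullback (f : P1_morphism F) A B (h : bundle_hom A B) :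
    bundle_hom (pullback f A) (pullback f B) :=
  @BundleHom F (pullback f A) (pullback f B)
    (fun x => hom_map h (x := f x)) _ _.
Next Obligation. by move=> f A B h x; exact: (@hom_linear _ _ _ h (f x)). Qed.
Next Obligation.
move=> f A B h i j; have [G rG GP] := @hom_reg _ _ _ h i j.
exists (G \o f); last by move=> x v ix jx; exact: GP.
move=> k l; rewrite -preimage_setI.
apply: (mor_reg (f := fun y => G y k l)) => //.
by apply: zopenI; exact: dom_open.
Qed.

Definition fib_cast A (x y : P1 F) (e : x = y) (v : fib A x) : fib A y :=
  eq_rect x (fun z => fib A z) v y e.

Lemma fib_cast_linear A (x y : P1 F) (e : x = y) : linear (fib_cast (A := A) e).
Proof. by case: _ / e. Qed.

Lemma triv_fib_cast A (i j : chart A) (x y : P1 F) (e : x = y)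
    (G : P1 F -> 'M[F]_(rank A)) :
  (forall z (v : fib A z), dom i z -> dom j z -> triv j v = triv i v *m G z) ->
  forall v : fib A x, dom i x -> dom j y ->
    triv j (fib_cast e v) = triv i v *m G y.
Proof. by move=> GP v; case: _ / e => ix jx; exact: GP. Qed.

(* The canonical isomorphism (f \o g)^* A = g^* (f^* A) -> h^* A when h and
   f \o g are the same map. *)
Program Definition pullback_cast (f g h : P1_morphism F)
    (e : forall x, f (g x) = h x) A :
    bundle_hom (pullback g (pullback f A)) (pullback h A) :=
  @BundleHom F (pullback g (pullback f A)) (pullback h A)
    (fun x => fib_cast (e x)) _ _.
Next Obligation. by move=> f g h e A x; exact: (@fib_cast_linear A _ _ (e x)). Qed.
Next Obligation.
move=> f g h e A i j; have [G rG GP] := @triv_trans _ A i j.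
exists (G \o h); last by move=> x v ix jx; exact: (@triv_fib_cast A i j _ _ (e x) G).
suff -> : dom (b := pullback g (pullback f A)) i = h @^-1` dom (b := A) i.
  move=> k l; rewrite -preimage_setI.
  apply: (mor_reg (f := fun y => G y k l)); last exact: (rG k l).
  by apply: zopenI; exact: dom_open.
by apply/seteqP; split => x; rewrite /= /preimage /= e.
Qed.

Program Definition pullback_cast_inv (f g h : P1_morphism F)
    (e : forall x, f (g x) = h x) A :
    bundle_hom (pullback h A) (pullback g (pullback f A)) :=
  @BundleHom F (pullback h A) (pullback g (pullback f A))
    (fun x => fib_cast (esym (e x))) _ _.
Next Obligation. by move=> f g h e A x; exact: (@fib_cast_linear A _ _ (esym (e x))). Qed.
Next Obligation.
move=> f g h e A i j; have [G rG GP] := @triv_trans _ A i j.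
exists (G \o (f \o g)); last first.
  by move=> x v ix jx; exact: (@triv_fib_cast A i j _ _ (esym (e x)) G).
suff -> : G \o (f \o g) = G \o h.
  suff -> : dom (b := pullback g (pullback f A)) j = h @^-1` dom (b := A) j.
    move=> k l; rewrite -preimage_setI.
    apply: (mor_reg (f := fun y => G y k l)); last exact: (rG k l).
    by apply: zopenI; exact: dom_open.
  by apply/seteqP; split => x; rewrite /= /preimage /= e.
by apply/funext => x /=; rewrite e.
Qed.

Definition sum_triv A B (ij : chart A * chart B) (x : P1 F)
    (v : fib A x * fib B x) : 'rV[F]_(rank A + rank B) :=
  row_mx (triv ij.1 v.1) (triv ij.2 v.2).

Program Definition bundle_sum A B : bundle F :=
  @Bundle F (rank A + rank B) (fun x => (fib A x * fib B x)%type : lmodType F)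
    (chart A * chart B)%type (fun ij => dom ij.1 `&` dom ij.2)
    (@sum_triv A B) _ _ _ _ _.
Next Obligation. by move=> A B ij; apply: zopenI; exact: dom_open. Qed.
Next Obligation.
move=> A B x; have [i ix] := dom_cover A x; have [j jx] := dom_cover B x.
by exists (i, j).
Qed.
Next Obligation.
move=> A B [i j] x [/= ix jx] a u v.
by rewrite /sum_triv /= !triv_linear // scale_row_mx add_row_mx.
Qed.
Next Obligation.
move=> A B [i j] x [/= ix jx].
have [g gK Kg] := triv_bij ix; have [h hK Kh] := triv_bij jx.
exists (fun w => (g (lsubmx w), h (rsubmx w))).
  by move=> [u v]; rewrite /sum_triv /= row_mxKl row_mxKr gK hK.
by move=> w; rewrite /sum_triv /= Kg Kh hsubmxK.
Qed.
Next Obligation.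
move=> A B [i j] [i' j'] /=.
have [G rG GP] := @triv_trans _ A i i'; have [H rH HP] := @triv_trans _ B j j'.
exists (fun x => block_mx (G x) 0 0 (H x)); last first.
  move=> x [u v] [/= ix jx] [ix' jx'].
  by rewrite /sum_triv /= GP // HP // mul_row_block !mulmx0 addr0 add0r.
move=> k l x [[/= ix jx] [ix' jx']].
have oi : zopen (dom i `&` dom i') by apply: zopenI; exact: dom_open.
have oj : zopen (dom j `&` dom j') by apply: zopenI; exact: dom_open.
set U := _ `&` _.
have oU : zopen U by do ![apply: zopenI]; exact: dom_open.
have Ux : U x by [].
have UiE : U = dom i `&` dom i' `&` (dom j `&` dom j') by rewrite /U setIACA.
have [k' ->|k' ->] := split_ordP k; have [l' ->|l' ->] := split_ordP l.
- apply: (@regular_at_loc _ U U (fun y => G y k' l')) => //.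
    by rewrite UiE; apply: regular_at_sub => //; exact: rG.
  by move=> y _; rewrite block_mxEul.
- apply: (@regular_at_loc _ U U (fun y => 0)) => //.
    exact: regular_at_cst.
  by move=> y _; rewrite block_mxEur mxE.
- apply: (@regular_at_loc _ U U (fun y => 0)) => //.
    exact: regular_at_cst.
  by move=> y _; rewrite block_mxEdl mxE.
- apply: (@regular_at_loc _ U U (fun y => H y k' l')) => //.
    by rewrite UiE setIC; apply: regular_at_sub => //; exact: rH.
  by move=> y _; rewrite block_mxEdr.
Qed.

Program Definition bundle0 : bundle F :=
  @Bundle F 0 (fun=> 'rV[F]_0 : lmodType F) unit (fun=> setT)
    (fun _ _ v => v) _ _ _ _ _.
Next Obligation. by move=> ?; exact: zopenT. Qed.
Next Obligation. by move=> x; exists tt. Qed.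
Next Obligation. by move=> ? ? _. Qed.
Next Obligation. by move=> ? ? _; exists id. Qed.
Next Obligation.
by move=> ? ?; exists (fun=> 0) => [[] //|x v _ _]; rewrite mulmx0 thinmx0.
Qed.

(* The line bundle O(k): trivial line bundles over z <> infinity (chart true)
   and z <> 0 (chart false), the fibre coordinates being related by
   s' = z ^ (- k) s.  For 0 <= k its global sections are the polynomials s in z
   of degree at most k. *)
Definition line_scal (k : int) (b : bool) (x : P1 F) : F :=
  if x is Some a then if b then 1 else a ^ (- k) else 1.

Definition line_dom (b : bool) : set (P1 F) :=
  if b then ~` [set None] else ~` [set Some 0].

Lemma line_dom_open b : zopen (line_dom b).
Proof. by right; case: b; rewrite /line_dom setCK; exact: finite_set1. Qed.

Lemma line_scal_neq0 k b x : line_dom b x -> line_scal k b x != 0.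
Proof.
case: x => [a|] /=; last by rewrite oner_neq0.
case: b => [|a0]; first by rewrite oner_neq0.
by apply: expfz_neq0; apply: contra_notN a0 => /eqP ->.
Qed.

Lemma regular_monomial (k : int) (x : P1 F) (U : set (P1 F)) :
  zopen U -> U x -> ~ U None -> ~ U (Some 0) ->
  regular_at U (fun y => if y is Some a then a ^ k else 1) x.
Proof.
move=> oU Ux Uoo U0; have n0 a : U (Some a) -> a != 0.
  by move=> Ua; apply/eqP => a0; apply: U0; rewrite -a0.
case: k => n.
- exists U, n, 'X^n, 1; rewrite size_polyXn size_poly1; split => //.
  by move=> [a|//] _ /=; rewrite hornerC hornerXn divr1 oner_neq0.
- exists U, n.+1, 1, 'X^(n.+1); rewrite size_polyXn size_poly1; split => //.
  move=> [a|//] /n0 a0 /=; rewrite hornerC hornerXn expf_neq0 //.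
  by rewrite div1r NegzE.
Qed.

Program Definition line_bundle (k : int) : bundle F :=
  @Bundle F 1 (fun=> F^o : lmodType F) bool line_dom
    (fun b x (v : F^o) => const_mx (line_scal k b x * v)) _ _ _ _ _.
Next Obligation. by move=> k b; exact: line_dom_open. Qed.
Next Obligation.
by move=> k [a|]; [exists true | exists false].
Qed.
Next Obligation.
move=> k b x _ a u v; apply/matrixP => i j; rewrite !mxE.
by rewrite mulrDr /GRing.scale /= mulrCA.
Qed.
Next Obligation.
move=> k b x /(line_scal_neq0 k) s0; exists (fun w : 'rV[F]_1 => (line_scal k b x)^-1 * w 0 0).
  by move=> v; rewrite mxE mulKf.
by move=> w; apply/matrixP => i j; rewrite mxE mulVKf // !ord1.
Qed.
Next Obligation.
move=> k b c; exists (fun x => const_mx ((line_scal k b x)^-1 * line_scal k c x)); last first.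
  move=> x v bx cx; apply/matrixP => i j; rewrite !mxE big_ord1 !mxE.
  by have := line_scal_neq0 k bx; move=> s0; rewrite mulrACA mulfV // mul1r mulrC.
move=> r s x [bx cx]; set U := line_dom b `&` line_dom c.
have oU : zopen U by apply: zopenI; exact: line_dom_open.
have Ux : U x by [].
have [bc|bc] := eqVneq b c.
  apply: (@regular_at_loc _ U U (fun=> 1)) => //; first exact: regular_at_cst.
  by move=> y [yb _]; rewrite mxE -bc mulVf // line_scal_neq0.
have [Uoo U0] : ~ U None /\ ~ U (Some 0).
  by rewrite /U; case: (b) (c) bc => [] [] //= _; split=> -[].
have n0 a : U (Some a) -> a != 0.
  by move=> Ua; apply/eqP => a0; apply: U0; rewrite -a0.
case: (b) (c) bc => [] [] //= _.
- apply: (@regular_at_loc _ U U (fun y => if y is Some a then a ^ (- k) else 1)) => //.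
    exact: regular_monomial.
  by move=> [a|//] _; rewrite mxE /= invr1 mul1r.
- apply: (@regular_at_loc _ U U (fun y => if y is Some a then a ^ k else 1)) => //.
    exact: regular_monomial.
  by move=> [a|//] _; rewrite mxE /= mulr1 invr_expz opprK.
Qed.

End BundleConstructions.

(* An object is represented by a bundle on P1_N, with N = level. *)
Record proalg (F : closedFieldType) := Proalg {
  level : nat;
  level_gt0 : (0 < level)%N;
  rep : bundle F
}.

Section Proalg.
Variable F : closedFieldType.
Implicit Types A B C : proalg F.
Local Obligation Tactic := idtac.

Definition proalg_rank A : nat := rank (rep A).

(* The pullback of the representative of A to P1_M, for level A %| M. *)
Definition rep_at A (M : nat) : bundle F := pullback (rho F M (level A)) (rep A).

(* A morphism is represented by a morphism of the pullbacks to a common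
   refinement P1_M, with M = hlevel. *)
Record proalg_hom A B := ProalgHom {
  hlevel : nat;
  hlevel_gt0 : (0 < hlevel)%N;
  hlevel_src : (level A %| hlevel)%N;
  hlevel_tgt : (level B %| hlevel)%N;
  hrep : bundle_hom (rep_at A hlevel) (rep_at B hlevel)
}.

(* The pullback of the representative of f to the refinement P1_L. *)
Definition hom_at A B (f : proalg_hom A B) (L : nat) (dvd_fL : (hlevel f %| L)%N) :
    bundle_hom (rep_at A L) (rep_at B L) :=
  let castA x := rho_comp x (level_gt0 A) (hlevel_gt0 f) (hlevel_src f) dvd_fL in
  let castB x := rho_comp x (level_gt0 B) (hlevel_gt0 f) (hlevel_tgt f) dvd_fL in
  hom_comp (pullback_cast_inv castA (rep A))
    (hom_comp (hom_pullback (rho F L (hlevel f)) (hrep f))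
       (pullback_cast castB (rep B))).

(* Equality in the filtered colimit of the Hom sets. *)
Definition proalg_hom_eq A B (f g : proalg_hom A B) : Prop :=
  exists (L : nat) (_ : (0 < L)%N) (dvd_fL : (hlevel f %| L)%N)
    (dvd_gL : (hlevel g %| L)%N),
    hom_eq (hom_at dvd_fL) (hom_at dvd_gL).

Definition proalg_id A : proalg_hom A A :=
  ProalgHom (level_gt0 A) (dvdnn _) (dvdnn _) (hom_id _).

Lemma hlevel_lcm_gt0 A B C (f : proalg_hom A B) (g : proalg_hom B C) :
  (0 < lcmn (hlevel f) (hlevel g))%N.
Proof. by rewrite lcmn_gt0 !hlevel_gt0. Qed.

Definition proalg_comp A B C (f : proalg_hom A B) (g : proalg_hom B C) :
    proalg_hom A C :=
  ProalgHom (hlevel_lcm_gt0 f g)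
    (dvdn_trans (hlevel_src f) (dvdn_lcml _ _))
    (dvdn_trans (hlevel_tgt g) (dvdn_lcmr _ _))
    (hom_comp (hom_at (dvdn_lcml (hlevel f) (hlevel g)))
              (hom_at (dvdn_lcmr (hlevel f) (hlevel g)))).

Definition proalg_iso A B : Prop :=
  exists (f : proalg_hom A B) (g : proalg_hom B A),
    proalg_hom_eq (proalg_comp f g) (proalg_id A) /\
    proalg_hom_eq (proalg_comp g f) (proalg_id B).

Lemma level_lcm_gt0 A B : (0 < lcmn (level A) (level B))%N.
Proof. by rewrite lcmn_gt0 !level_gt0. Qed.

Definition proalg_sum A B : proalg F :=
  Proalg (level_lcm_gt0 A B)
    (bundle_sum (rep_at A (lcmn (level A) (level B)))
                (rep_at B (lcmn (level A) (level B)))).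

Definition proalg0 : proalg F := Proalg (ltn0Sn 0) (bundle0 F).

Lemma denq_abs_gt0 (q : rat) : (0 < `|denq q|)%N.
Proof. by rewrite absz_gt0 denq_neq0. Qed.

(* O(k / N) = p_N^* O(k), with k / N in lowest terms; see [line_proalg_wd] for
   other fractions. *)
Definition line_proalg (q : rat) : proalg F :=
  Proalg (denq_abs_gt0 q) (line_bundle F (numq q)).

Lemma fib_cast_line (k : int) (x y : P1 F) (e : x = y) (v : F^o) :
  fib_cast (A := line_bundle F k) e v = v.
Proof. by case: _ / e. Qed.

Lemma line_pullback_reg (k l : int) (d e : nat) : (0 < d)%N -> (0 < e)%N ->
  k * d%:Z = l * e%:Z ->
  forall b c : bool, exists2 G : P1 F -> 'M[F]_1,
    regular_mx ((@pow_fun F d @^-1` @line_dom F b) `&`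
                (@pow_fun F e @^-1` @line_dom F c)) G &
    forall x (v : F^o), @line_dom F b (pow_fun d x) -> @line_dom F c (pow_fun e x) ->
      @triv F (line_bundle F l) c (pow_fun e x) v =
      @triv F (line_bundle F k) b (pow_fun d x) v *m G x.
Proof.
move=> d0 e0 kl b c.
have scalE x : line_scal k c (@pow_fun F d x) = line_scal l c (pow_fun e x).
  case: d e d0 e0 kl => [|d] [|e] // _ _ kl; case: x => [a|] //=; case: c => //.
  by rewrite ![_ ^+ _]exprnP !exprz_exp !mulrN ![_%:Z * _]mulrC kl.
have domE : @pow_fun F e @^-1` @line_dom F c = @pow_fun F d @^-1` @line_dom F c.
  apply/seteqP; split=> -[a|]; case: d e d0 e0 {kl scalE} => [|d] [|e] // _ _;
    rewrite /line_dom /preimage /=; case: c => //= H -[] /eqP;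
    by rewrite expf_eq0 /= => /eqP a0; apply: H; rewrite a0 expr0n.
have [G rG GP] := @triv_trans _ (pullback (pow_morphism F d) (line_bundle F k)) b c.
exists G; first by rewrite domE.
move=> x v bx cx; rewrite -[RHS](GP x v) //=; first by rewrite scalE.
by move: cx; rewrite -[line_dom _ _]/((@pow_fun F e @^-1` @line_dom F c) x) domE.
Qed.

Program Definition line_proalg_hom (k l : int) (N N' : nat)
    (N0 : (0 < N)%N) (N0' : (0 < N')%N) (E : k * N'%:Z = l * N%:Z) :
    proalg_hom (Proalg N0 (line_bundle F k)) (Proalg N0' (line_bundle F l)) :=
  @ProalgHom (Proalg N0 (line_bundle F k)) (Proalg N0' (line_bundle F l))
    (N * N')%N _ (dvdn_mulr _ (dvdnn _)) (dvdn_mull _ (dvdnn _))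
    (@BundleHom F (rep_at (Proalg N0 (line_bundle F k)) (N * N'))
       (rep_at (Proalg N0' (line_bundle F l)) (N * N')) (fun x (v : F^o) => v) _ _).
Next Obligation. by move=> *; rewrite muln_gt0; apply/andP. Qed.
Next Obligation. by []. Qed.
Next Obligation.
by move=> k l N N' N0 N0' E; apply: line_pullback_reg; rewrite /= ?mulKn ?mulnK.
Qed.

Lemma hom_at_line (k l : int) (N N' : nat) (N0 : (0 < N)%N) (N0' : (0 < N')%N)
  (f : proalg_hom (Proalg N0 (line_bundle F k)) (Proalg N0' (line_bundle F l)))
  (L : nat) (dvd_fL : (hlevel f %| L)%N) :
  (forall x (v : F^o), @hom_map _ _ _ (hrep f) x v = v :> F^o) ->
  forall x (v : F^o), @hom_map _ _ _ (hom_at dvd_fL) x v = v :> F^o.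
Proof.
move=> H x v.
refine (etrans (@fib_cast_line l _ _ _ _) _).
refine (etrans (H _ _) _).
exact: (@fib_cast_line k _ _ _ _).
Qed.

Lemma proalg_comp_line (k l m : int) (N N' N2 : nat)
  (N0 : (0 < N)%N) (N0' : (0 < N')%N) (N20 : (0 < N2)%N)
  (f : proalg_hom (Proalg N0 (line_bundle F k)) (Proalg N0' (line_bundle F l)))
  (g : proalg_hom (Proalg N0' (line_bundle F l)) (Proalg N20 (line_bundle F m))) :
  (forall x (v : F^o), @hom_map _ _ _ (hrep f) x v = v :> F^o) ->
  (forall x (v : F^o), @hom_map _ _ _ (hrep g) x v = v :> F^o) ->
  forall x (v : F^o), @hom_map _ _ _ (hrep (proalg_comp f g)) x v = v :> F^o.
Proof.
move=> Hf Hg x v.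
refine (etrans (@hom_at_line l m N' N2 N0' N20 g _ _ Hg _ _) _).
exact: (@hom_at_line k l N N' N0 N0' f _ _ Hf _ _).
Qed.

(* The object represented by O(k) on P1_N depends only on k / N. *)
Lemma line_proalg_wd (k : int) (N : nat) (N0 : (0 < N)%N) :
  proalg_iso (Proalg N0 (line_bundle F k)) (line_proalg (k%:Q / N%:Q)).
Proof.
set q := k%:Q / N%:Q.
have N0' : N%:Q != 0 :> rat by rewrite intr_eq0 -lt0n.
have E : k * `|denq q|%N%:Z = numq q * N%:Z.
  apply: (@intr_inj rat); rewrite !intrM absz_denq.
  rewrite -[in RHS](divfK (_ : (denq q)%:~R != 0) (numq q)%:~R) ?intr_eq0 ?denq_neq0 //.
  by rewrite divq_num_den mulrAC divfK.
exists (line_proalg_hom N0 (denq_abs_gt0 q) E).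
exists (line_proalg_hom (denq_abs_gt0 q) N0 (esym E)).
split; set f := proalg_comp _ _; exists (hlevel f); exists (hlevel_gt0 f);
  exists (dvdnn _); exists (hlevel_src f) => x v.
- refine (etrans (@hom_at_line k k N N N0 N0 f _ _ _ x v)
    (esym (@hom_at_line k k N N N0 N0 _ _ _ _ x v))); last by [].
  by apply: (@proalg_comp_line k (numq q) k).
- refine (etrans (@hom_at_line _ _ _ _ _ _ f _ _ _ x v)
    (esym (@hom_at_line (numq q) (numq q) _ _ _ _ _ _ _ _ x v))); last by [].
  by apply: (@proalg_comp_line (numq q) k (numq q)).
Qed.

End Proalg.

(* Main.v *)
Require Import Defs.
From HB Require Import structures.
From mathcomp Require Import all_boot all_order all_algebra.
From mathcomp Require Import boolp classical_sets cardinality reals complex.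
From mathcomp Require Import perm zify ring.

Set Implicit Arguments.
Unset Strict Implicit.
Unset Printing Implicit Defensive.
Import Order.TTheory GRing.Theory Num.Theory.

(** The existence half is Grothendieck's splitting theorem on one projective
    line, proved by maximizing a degree; the uniqueness half is a permutation
    argument on a matrix of homogeneous forms.

    Everything is phrased with weighted functions: [wreg w f x] says that near
    x the function f is a quotient of forms whose degrees differ by w, that is,
    a local section of O(w).  A global one of negative weight vanishes
    ([liouville]).  A morphism O(k) -> E is a section of E of weight - k
    ([wsec]), and a splitting of E into the O(k_r) is a [frame]: sections s_r of
    weight - k_r that form a basis of every fibre.

    Existence of a frame ([exists_frame]).  A basis in one chart, multiplied by
    a form that kills the poles, gives n sections that are independent at one
    point x0 ([initial_sections]).  If the sections are dependent at some x,
    take a relation with coefficients v_r and an index i with k_i minimal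
    among those with v_i <> 0: multiplying the other terms by powers of a
    linear form that is 1 at x turns the relation into a section of weight
    - k_i that vanishes at x; divide it by the linear form vanishing at x and
    put it in place of s_i ([raise_degree]).  Independence at x0 survives and
    the sum of the k_r grows by one.  This must stop, because the determinant
    of the sections in the chart, cleared of poles, is a nonzero global function
    of weight n M - sum k_r ([degree_bound]).  When it stops, the sections are
    independent everywhere.

    In the colimit, [splits A q] says that on some line P1_L above the level of
    A there is a frame of degrees L q_r.  Every object splits
    ([exists_splits]), the sum of the O(q_r) splits along q ([splits_big_sum]),
    and two objects that split along the same q are isomorphic
    ([iso_of_splits]), since matching frames over a common refinement define
    mutually inverse morphisms.

    Uniqueness ([splits_unique]).  In frames of degrees k and l, an entry (i, j)
    of an isomorphism is a global function of weight l_j - k_i, so it can be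
    nonzero only if k_i <= l_j.  The matrix at a point being invertible, some
    term of its Leibniz expansion is nonzero, which gives a permutation s with
    k_i <= l_(s i) for all i.  The inverse isomorphism bounds the sums the other
    way, so all these inequalities are equalities ([perm_eq_of_matrices]). *)

(** * Weighted regular functions on the projective line *)

Section WeightedFunctions.
Variable F : closedFieldType.
Local Open Scope classical_set_scope.
Local Open Scope ring_scope.
Implicit Types (U V W : set (P1 F)) (f g : P1 F -> F) (x y : P1 F) (p q : {poly F}).

Lemma form_val0 d x : form_val d (0 : {poly F}) x = 0.
Proof. by case: x => [a|] /=; rewrite ?horner0 ?coef0. Qed.

(** An algebraically closed field is infinite: multiplying by linear factors for
    the finitely many excluded points reduces to a polynomial without
    non-roots. *)
Lemma poly0_cofinite p V : zopen V -> V !=set0 ->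
  (forall a, V (Some a) -> p.[a] = 0) -> p = 0.
Proof.
move=> oV [z Vz] pV; case: oV Vz => [->//|/finite_seqP[s sE]] _.
pose r := \prod_(b <- s) (if b is Some a then 'X - a%:P else 1) : {poly F}.
have r0 : r != 0.
  rewrite prodf_seq_neq0; apply/allP => -[a|] _ /=; last exact: oner_neq0.
  by rewrite polyXsubC_eq0.
apply/eqP; rewrite -[_ == 0]orbF -(negbTE r0) -mulf_eq0.
apply: contraT => /closed_nonrootP[a]; rewrite rootM negb_or => /andP[pa /negP ra].
have Va : ~ V (Some a) by move=> /pV pa0; move: pa; rewrite /root pa0 eqxx.
exfalso; apply: ra; have : [set` s] (Some a) by rewrite -sE.
move=> /= as_; rewrite /r (big_rem _ as_) /= rootM root_XsubC eqxx //.
Qed.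

Lemma form_eq d p q V : zopen V -> V !=set0 ->
  (forall y, V y -> form_val d p y = form_val d q y) -> p = q.
Proof.
move=> oV V0 pq; apply/eqP; rewrite -subr_eq0; apply/eqP.
apply: (poly0_cofinite oV V0) => a Va.
by rewrite hornerD hornerN; have /= -> := pq _ Va; rewrite subrr.
Qed.

Lemma zopen_meet V W : zopen V -> zopen W -> V !=set0 -> W !=set0 ->
  (V `&` W) !=set0.
Proof.
move=> oV oW V0 W0; apply/set0P/negP => /eqP VW0.
have oVW : zopen (~` V `|` ~` W) by rewrite -setCI VW0 setC0; exact: zopenT.
have fin U : zopen U -> U !=set0 -> finite_set (~` U).
  by move=> [->|//] [x].
have : finite_set [set: P1 F].
  by rewrite -setC0 -VW0 setCI finite_setU; split; exact: fin.
move=> fT; have : (1 : {poly F}) = 0.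
  apply: (@poly0_cofinite 1 [set None]); [|by exists None|by []].
  by right; apply: sub_finite_set fT.
by move/eqP; rewrite oner_eq0.
Qed.

Lemma form_val_inf d p (sp : (size p <= d.+1)%N) :
  form_val d p None = 0 -> (size p <= d)%N.
Proof.
move=> /= pd; move: sp; rewrite leq_eqVlt ltnS => /orP[/eqP sp|//].
have : lead_coef p == 0 by rewrite lead_coefE sp pd.
by rewrite lead_coef_eq0 => /eqP->; rewrite size_poly0.
Qed.

Lemma zopen_form_neq0 d p : (size p <= d.+1)%N ->
  zopen [set y | form_val d p y != 0].
Proof.
move=> sp; have [->|p0] := eqVneq p 0.
  by left; apply/seteqP; split => y //=; rewrite form_val0 eqxx.
right; have [s sE] := closed_field_poly_normal p.
apply: (@sub_finite_set _ _ [set` None :: map Some s]); last exact: finite_seq.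
move=> [a|] /=; last by rewrite in_cons.
move=> /negP; rewrite negbK in_cons /= mem_map; last by move=> ? ? [].
rewrite sE -[_ == 0]/(root _ a) rootZ ?root_prod_XsubC //.
by rewrite lead_coef_eq0.
Qed.

(** The linear form that vanishes exactly at x, dehomogenized: z - a at a finite
    point, and w (that is, 1) at infinity. *)
Definition ell_poly x : {poly F} := if x is Some a then 'X - a%:P else 1.

Definition ell x y : F := form_val 1 (ell_poly x) y.

(** A linear form equal to 1 at x, used to change weights without creating a
    zero at x. *)
Definition unit_poly x : {poly F} := if x is Some a then 1 else 'X.

Definition lunit x y : F := form_val 1 (unit_poly x) y.

Lemma size_ell x : (size (ell_poly x) <= 2)%N.
Proof. by case: x => [a|] /=; rewrite ?size_XsubC ?size_poly1. Qed.

Lemma size_unit x : (size (unit_poly x) <= 2)%N.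
Proof. by case: x => [a|] /=; rewrite ?size_polyX ?size_poly1. Qed.

Lemma ell_eq0 x y : (ell x y == 0) = (x == y).
Proof.
rewrite /ell; case: x y => [a|] [b|] /=;
  rewrite ?hornerXsubC ?hornerC ?coefB ?coefC ?coefX ?subr0 ?oner_eq0 ?eqxx //.
by rewrite subr_eq0 eq_sym.
Qed.

Lemma lunit1 x : lunit x x = 1.
Proof. by rewrite /lunit; case: x => [a|] /=; rewrite ?hornerC ?coefX. Qed.

Lemma ell_poly_neq0 x : ell_poly x != 0.
Proof. by case: x => [a|] /=; rewrite ?polyXsubC_eq0 ?oner_neq0. Qed.

Lemma form_div d p x : (size p <= d.+2)%N -> form_val d.+1 p x = 0 ->
  exists2 p' : {poly F}, (size p' <= d.+1)%N & p = ell_poly x * p'.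
Proof.
move=> sp; case: x => [a|] p0; last first.
  by exists p; [exact: form_val_inf p0 | rewrite mul1r].
move/eqP: (p0); rewrite -[_ == 0]/(root p a) => /factor_theorem[p' pE].
exists p'; last by rewrite mulrC.
have [->|p'0] := eqVneq p' 0; first by rewrite size_poly0.
by move: sp; rewrite pE size_Mmonic ?monicXsubC // size_XsubC addn2.
Qed.

(** Germs at x of sections of O(w).  The degrees are natural numbers, so a
    negative weight comes from a denominator of larger degree. *)
Definition wreg (w : int) f x : Prop :=
  exists V (d e : nat) p q,
    [/\ zopen V, V x, (size p <= d.+1)%N /\ (size q <= e.+1)%N,
        d%:Z = e%:Z + w &
        forall y, V y ->
          form_val e q y != 0 /\ f y = form_val d p y / form_val e q y].

Lemma regular_wreg U f x : regular_at U f x -> wreg 0 f x.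
Proof.
move=> [V [d [p [q [oV Vx VU sz H]]]]].
by exists V, d, d, p, q; split; rewrite ?addr0.
Qed.

Lemma wreg_regular U f x : zopen U -> U x -> wreg 0 f x -> regular_at U f x.
Proof.
move=> oU Ux [V [d [e [p [q [oV Vx sz + H]]]]]];
rewrite addr0 => /eqP; rewrite eqz_nat => /eqP de.
rewrite -de in sz H; exists (V `&` U), d, p, q; split => //; first exact: zopenI.
- by move=> y [Vy _]; exact: H.
Qed.

Lemma wreg_eq w V f g x : zopen V -> V x -> (forall y, V y -> f y = g y) ->
  wreg w f x -> wreg w g x.
Proof.
move=> oV Vx fg [W [d [e [p [q [oW Wx sz de H]]]]]].
exists (V `&` W), d, e, p, q; split => //; first exact: zopenI.
by move=> y [Vy /H]; rewrite fg.
Qed.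

Lemma wreg_ext w f g x : f =1 g -> wreg w f x -> wreg w g x.
Proof. by move=> fg; apply: (wreg_eq (@zopenT F)). Qed.

Lemma wreg_form d p x : (size p <= d.+1)%N -> wreg d%:Z (form_val d p) x.
Proof.
move=> sp; exists setT, d, 0%N, p, 1; split; rewrite ?size_poly1 ?add0r //.
  exact: zopenT.
by move=> [a|] _ /=; rewrite ?hornerC ?coefC /= ?divr1 oner_neq0.
Qed.

Lemma wreg_ell x y : wreg 1 (ell x) y.
Proof. exact: wreg_form (size_ell x). Qed.

Lemma wreg_lunit x y : wreg 1 (lunit x) y.
Proof. exact: wreg_form (size_unit x). Qed.

Lemma wreg_cst c x : wreg 0 (fun=> c) x.
Proof. by apply: (@regular_wreg setT); apply: regular_at_cst => //; exact: zopenT. Qed.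

Lemma wregM w w' f g x : wreg w f x -> wreg w' g x ->
  wreg (w + w') (fun y => f y * g y) x.
Proof.
move=> [V [d [e [p [q [oV Vx [sp sq] de H]]]]]]
  [V' [d' [e' [p' [q' [oV' V'x [sp' sq'] de' H']]]]]].
exists (V `&` V'), (d + d')%N, (e + e')%N, (p * p'), (q * q'); split => //.
- exact: zopenI.
- by split; exact: size_formM.
- by rewrite !PoszD de de' addrACA.
- move=> y [/H [n0 ->] /H' [n0' ->]]; rewrite !form_valM //; split.
    by rewrite mulf_neq0.
  by rewrite mulf_div.
Qed.

Lemma wregD w f g x : wreg w f x -> wreg w g x -> wreg w (fun y => f y + g y) x.
Proof.
move=> [V [d [e [p [q [oV Vx [sp sq] de H]]]]]]
  [V' [d' [e' [p' [q' [oV' V'x [sp' sq'] de' H']]]]]].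
have E : (d + e' = d' + e)%N.
  by lia.
exists (V `&` V'), (d + e')%N, (e + e')%N, (p * q' + p' * q), (q * q'); split => //.
- exact: zopenI.
- split; last exact: size_formM.
  by apply: (leq_trans (size_polyD _ _)); rewrite geq_max size_formM //= E size_formM.
- by rewrite !PoszD de addrAC.
- move=> y [/H [n0 ->] /H' [n0' ->]]; rewrite form_valD.
  have -> : form_val (d + e') (p' * q) y = form_val d' p' y * form_val e q y.
    by rewrite E form_valM.
  rewrite !form_valM //; split; first by rewrite mulf_neq0.
  by rewrite addf_div.
Qed.

Lemma wreg_lunitV x : wreg (-1) (fun y => (lunit x y)^-1) x.
Proof.
exists [set y | lunit x y != 0], 0%N, 1%N, 1, (unit_poly x); split => //.
- exact: zopen_form_neq0 (size_unit x).
- by rewrite /= lunit1 oner_neq0.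
- by rewrite size_poly1; split => //; exact: size_unit.
- by move=> [a|] n0; split => //=; rewrite ?hornerC ?coefC /= mul1r.
Qed.

Lemma wregX w f x n : wreg w f x -> wreg (w *+ n) (fun y => f y ^+ n) x.
Proof.
move=> wf; elim: n => [|n IH].
  by apply: (@wreg_ext _ (fun=> 1)); [move=> y; rewrite expr0 | exact: wreg_cst].
rewrite mulrS; apply: (@wreg_ext _ (fun y => f y * f y ^+ n)).
  by move=> y; rewrite exprS.
exact: wregM.
Qed.

(** Some function of weight w exists near x, a power of [lunit x]; multiply it
    by 0. *)
Lemma wreg0 w x : wreg w (fun=> 0) x.
Proof.
suff [u wu] : exists u, wreg w u x.
  rewrite -[w]addr0; apply: (@wreg_ext _ (fun y => u y * 0)).
    by move=> y; rewrite mulr0.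
  by apply: wregM => //; exact: wreg_cst.
case: w => n.
  exists (fun y => lunit x y ^+ n).
  by have := wregX n (wreg_lunit x x); rewrite natz.
exists (fun y => (lunit x y)^-1 ^+ n.+1).
by have := wregX n.+1 (wreg_lunitV x); rewrite mulNrn natz.
Qed.

Lemma wreg_sum (I : Type) (r : seq I) (P : pred I) w (h : I -> P1 F -> F) x :
  (forall i, P i -> wreg w (h i) x) -> wreg w (fun y => \sum_(i <- r | P i) h i y) x.
Proof.
move=> wh; elim: r => [|i r IH].
  by apply: (@wreg_ext _ (fun=> 0)); [move=> y; rewrite big_nil | exact: wreg0].
apply: (@wreg_ext _ (fun y => (if P i then h i y else 0) + \sum_(i <- r | P i) h i y)).
  by move=> y; rewrite big_cons; case: (P i); rewrite ?add0r.
apply: wregD IH; case Pi: (P i); [exact: wh | exact: wreg0].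
Qed.

Lemma wreg_prod (I : Type) (r : seq I) (w : I -> int) (h : I -> P1 F -> F) x :
  (forall i, wreg (w i) (h i) x) ->
  wreg (\sum_(i <- r) w i) (fun y => \prod_(i <- r) h i y) x.
Proof.
move=> wh; elim: r => [|i r IH].
  rewrite big_nil; apply: (@wreg_ext _ (fun=> 1)); last exact: wreg_cst.
  by move=> y; rewrite big_nil.
rewrite big_cons; apply: (@wreg_ext _ (fun y => h i y * \prod_(i <- r) h i y)).
  by move=> y; rewrite big_cons.
exact: wregM.
Qed.

Lemma wreg_near_neq0 w f x : wreg w f x -> f x != 0 ->
  exists V, [/\ zopen V, V x & forall y, V y -> f y != 0].
Proof.
move=> [V [d [e [p [q [oV Vx [sp sq] de H]]]]]] fx.
exists (V `&` [set y | form_val d p y != 0]); split.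
- by apply: zopenI => //; exact: zopen_form_neq0.
- split=> //=; move: fx; have [_ ->] := H _ Vx.
  by rewrite mulf_eq0 negb_or => /andP[].
- by move=> y [/H[q0 ->] /= p1]; rewrite mulf_neq0 ?invr_eq0.
Qed.

Lemma wregV w f x : wreg w f x -> f x != 0 -> wreg (- w) (fun y => (f y)^-1) x.
Proof.
move=> wf /(wreg_near_neq0 wf)[W [oW Wx nW]].
case: wf => [V [d [e [p [q [oV Vx [sp sq] de H]]]]]].
exists (V `&` W), e, d, q, p; split => //; first exact: zopenI.
- by rewrite de addrK.
- move=> y [/H[q0 fE] /nW]; rewrite fE invf_div mulf_eq0 negb_or => /andP[p0 _].
  by split.
Qed.

(** The numerator of a quotient of forms that vanishes at x is divisible by the
    linear form of x. *)
Lemma wreg_div_ell w f x : wreg w f x -> f x = 0 ->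
  exists g, wreg (w - 1) g x /\ exists V,
    [/\ zopen V, V x & forall y, V y -> f y = ell x y * g y].
Proof.
move=> [V [d [e [p [q [oV Vx [sp sq] de H]]]]]] fx0.
have p0 : form_val d p x = 0.
  have [q0] := H _ Vx; rewrite fx0 => /esym/eqP.
  by rewrite mulf_eq0 invr_eq0 (negbTE q0) orbF => /eqP.
case: d => [|d] in sp de H p0 *.
  have pz : p = 0.
    apply/eqP; move: p0 sp => + /size1_polyC pE; rewrite pE.
    by case: x {fx0 Vx} => [a|] /=; rewrite ?hornerC ?coefC /= => ->.
  exists (fun=> 0); split; first exact: wreg0.
  by exists V; split => // y /H[_ ->]; rewrite pz form_val0 mul0r mulr0.
have [p' sp' pE] := form_div sp p0.
exists (fun y => form_val d p' y / form_val e q y); split; last first.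
  exists V; split => // y /H[_ ->]; rewrite pE -(addn1 d) addnC.
  by rewrite form_valM ?size_ell // mulrA.
exists V, d, e, p', q; split => //; last by move=> y /H[].
by rewrite addrA -de intS [1 + _]addrC addrK.
Qed.

(** If e0 is positive, q0 has a zero x; as p0 / q0 is defined there, p0
    vanishes at x too, and the linear form of x cancels.  Iterating, the
    denominator becomes constant and w is the degree of the numerator. *)
Lemma liouville_forms e0 d0 w p0 q0 : p0 != 0 -> q0 != 0 ->
  (size p0 <= d0.+1)%N -> (size q0 <= e0.+1)%N -> d0%:Z = e0%:Z + w ->
  (forall x, exists (d e : nat) p q,
    [/\ (size p <= d.+1)%N /\ (size q <= e.+1)%N, d%:Z = e%:Z + w,
        form_val e q x != 0 & p0 * q = p * q0]) ->
  0 <= w.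
Proof.
elim: e0 d0 p0 q0 => [|e0 IH] d0 p0 q0 pn0 qn0 sp0 sq0 de0 H.
  by move: de0; rewrite add0r => <-.
have [x qx] : exists x, form_val e0.+1 q0 x = 0.
  have [sq|] := eqVneq (size q0) e0.+2; last first.
    move=> sq; exists None => /=; apply: nth_default.
    by move: sq0; rewrite leq_eqVlt (negbTE sq) ltnS.
  have : size q0 != 1%N by rewrite sq.
  by move=> /closed_rootP[a /eqP qa]; exists (Some a).
have [d [e [p [q [[sp sq] de qx0 E]]]]] := H x.
have E' : (d + e0.+1 = d0 + e)%N.
  by lia.
have p0x : form_val d0 p0 x = 0.
  have : form_val (d0 + e) (p0 * q) x = 0.
    by rewrite E -E' form_valM // qx mulr0.
  by rewrite form_valM // => /eqP; rewrite mulf_eq0 (negbTE qx0) orbF => /eqP.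
case: d0 => [|d0] in sp0 de0 E' p0x *.
  case/eqP: pn0; move: p0x; rewrite (size1_polyC sp0).
  by case: (x) => [a|] /=; rewrite ?hornerC ?coefC /= => ->.
have [p' sp' pE] := form_div sp0 p0x.
have [q' sq' qE] := form_div sq0 qx.
have lx := ell_poly_neq0 x.
apply: (IH d0 p' q') => //.
- by apply: contraNneq pn0 => p'0; rewrite pE p'0 mulr0.
- by apply: contraNneq qn0 => q'0; rewrite qE q'0 mulr0.
- by move: de0; rewrite !intS -addrA => /addrI.
- move=> y; have [d1 [e1 [p1 [q1 [s1 de1 q1y E1]]]]] := H y.
  exists d1, e1, p1, q1; split => //; apply: (mulfI lx).
  by rewrite mulrA -pE E1 qE mulrCA.
Qed.

(** All local expressions of f agree with the one at x0 as fractions of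
    polynomials, because nonempty open sets meet in cofinite sets. *)
Lemma liouville w f x0 : (forall x, wreg w f x) -> f x0 != 0 -> 0 <= w.
Proof.
move=> wf fx0.
have [V0 [d0 [e0 [p0 [q0 [oV0 V0x [sp0 sq0] de0 H0]]]]]] := wf x0.
have [q0x fE] := H0 _ V0x.
have p0x : form_val d0 p0 x0 != 0.
  by move: fx0; rewrite fE mulf_eq0 negb_or => /andP[].
apply: (@liouville_forms e0 d0 w p0 q0) => //.
- by apply: contraNneq p0x => ->; rewrite form_val0.
- by apply: contraNneq q0x => ->; rewrite form_val0.
- move=> x; have [V [d [e [p [q [oV Vx [sp sq] de H]]]]]] := wf x.
  exists d, e, p, q; split => //; first by have [] := H _ Vx.
  apply: (@form_eq (d0 + e)%N _ _ (V0 `&` V)).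
  + exact: zopenI.
  + by apply: zopen_meet => //; [exists x0 | exists x].
  + move=> y [/H0[q0y E0] /H[qy]]; rewrite E0 => /eqP; rewrite eqr_div // => /eqP E.
    rewrite form_valM // E.
    suff -> : (d0 + e = d + e0)%N by rewrite form_valM.
    by lia.
Qed.

Lemma wreg_pow w f d x : (0 < d)%N -> wreg w f (pow_fun d x) ->
  wreg (w * d%:Z) (f \o pow_fun d) x.
Proof.
move=> d0 [V [m [e [p [q [oV Vx [sp sq] de H]]]]]].
exists (pow_fun d @^-1` V), (m * d)%N, (e * d)%N, (p \Po 'X^d), (q \Po 'X^d).
split => //.
- exact: pow_cont.
- by split; exact: size_form_pow.
- by rewrite !PoszM de mulrDl.
- by move=> y /H; rewrite /= !form_val_pow.
Qed.

End WeightedFunctions.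

(** * Matrices of weighted functions *)

Section WeightedMatrices.
Variable F : closedFieldType.
Local Open Scope classical_set_scope.
Local Open Scope ring_scope.
Implicit Types (V W : set (P1 F)) (x y : P1 F).

(** Local morphisms from a sum of O(- a_i) to a sum of O(b_j); with such a
    grading, products and inverses have predictable weights. *)
Definition wmx m n (a : 'I_m -> int) (b : 'I_n -> int)
    (G : P1 F -> 'M[F]_(m, n)) x : Prop :=
  forall i j, wreg (a i + b j) (fun y => G y i j) x.

Lemma wmx_eq m n a b V (G H : P1 F -> 'M[F]_(m, n)) x : zopen V -> V x ->
  (forall y, V y -> G y = H y) -> wmx a b G x -> wmx a b H x.
Proof.
move=> oV Vx GH wG i j; apply: wreg_eq oV Vx _ (wG i j) => y Vy.
by rewrite GH.
Qed.

Lemma wmxM m n l (a : 'I_m -> int) (b b' : 'I_n -> int) (c : 'I_l -> int)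
    (G : P1 F -> 'M[F]_(m, n)) (H : P1 F -> 'M[F]_(n, l)) x :
  (forall r, b' r = - b r) -> wmx a b G x -> wmx b' c H x ->
  wmx a c (fun y => G y *m H y) x.
Proof.
move=> b'E wG wH i j.
apply: (@wreg_ext _ _ (fun y => \sum_r G y i r * H y r j)).
  by move=> y; rewrite mxE.
apply: wreg_sum => r _; have := wregM (wG i r) (wH r j).
by congr (wreg _ _ x); rewrite b'E; ring.
Qed.

(** Each term of the Leibniz expansion takes every row and every column once,
    so all of them have the same weight. *)
Lemma wmx_det n (a b : 'I_n -> int) (G : P1 F -> 'M[F]_n) x : wmx a b G x ->
  wreg (\sum_i a i + \sum_i b i) (fun y => \det (G y)) x.
Proof.
move=> wG; rewrite /determinant; apply: wreg_sum => s _.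
rewrite -[X in wreg X]add0r; apply: wregM; first exact: wreg_cst.
have -> : \sum_i a i + \sum_i b i = \sum_i (a i + b (s i)).
  rewrite big_split /=; congr (_ + _).
  by rewrite (reindex_inj (@perm_inj _ s)).
by apply: wreg_prod => i; exact: wG.
Qed.

(** Cramer's rule: the cofactor omits row j and column i, whose weights are
    therefore the ones left after division by the determinant. *)
Lemma wmx_inv n (a b : 'I_n -> int) (G : P1 F -> 'M[F]_n) x : wmx a b G x ->
  G x \in unitmx ->
  wmx (fun i => - b i) (fun i => - a i) (fun y => invmx (G y)) x.
Proof.
move=> wG; rewrite unitmxE unitfE => Gx i j.
have wd := wmx_det wG; have [V [oV Vx dV]] := wreg_near_neq0 wd Gx.
apply: (@wreg_eq _ _ V
  (fun y => (\det (G y))^-1 * ((-1) ^+ (j + i) * \det (row' j (col' i (G y)))))) => //.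
  by move=> y /dV dy; rewrite /invmx unitmxE unitfE dy !mxE.
have wm : wmx (a \o lift j) (b \o lift i) (fun y => row' j (col' i (G y))) x.
  move=> r s; apply: (@wreg_ext _ _ (fun y => G y (lift j r) (lift i s))).
    by move=> y; rewrite !mxE.
  exact: wG.
have := wregM (wregV wd Gx) (wregM (wreg_cst ((-1) ^+ (j + i)) x) (wmx_det wm)).
rewrite (bigD1_ord j) //= (bigD1_ord (P := xpredT) (F := b) i) //=.
by congr (wreg _ _ x); ring.
Qed.

End WeightedMatrices.

(** * Clearing poles *)

Section ClearingPoles.
Variable F : closedFieldType.
Local Open Scope classical_set_scope.
Local Open Scope ring_scope.
Implicit Types (V W : set (P1 F)) (f g : P1 F -> F) (x y : P1 F) (p q : {poly F}).

Lemma form_order d q x : q != 0 -> (size q <= d.+1)%N ->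
  exists (r e : nat) (q' : {poly F}), [/\ d = (r + e)%N, (size q' <= e.+1)%N,
    form_val e q' x != 0 & forall y, form_val d q y = ell x y ^+ r * form_val e q' y].
Proof.
elim: d q => [|d IH] q q0 sq.
  exists 0%N, 0%N, q; split => //; last by move=> y; rewrite expr0 mul1r.
  apply: contraNneq q0; rewrite (size1_polyC sq).
  by case: (x) => [a|] /=; rewrite ?hornerC ?coefC /= => ->.
have [qx|qx] := eqVneq (form_val d.+1 q x) 0; last first.
  by exists 0%N, d.+1, q; split => // y; rewrite expr0 mul1r.
have [q1 sq1 qE] := form_div sq qx.
have q10 : q1 != 0 by apply: contraNneq q0 => q10; rewrite qE q10 mulr0.
have [r [e [q' [dE sq' q'x E]]]] := IH _ q10 sq1; rewrite {}dE in sq1 E *.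
exists r.+1, e, q'; split => // y.
by rewrite qE -[(r + e).+1]/(1 + (r + e))%N form_valM ?size_ell // E exprS mulrA.
Qed.

Lemma zopenU1 V x : zopen V -> V !=set0 -> zopen (V `|` [set x]).
Proof.
move=> [->|fV] [z Vz] //; right.
by apply: sub_finite_set fV; apply: subsetC; exact: subsetUl.
Qed.

(** A function regular at a single point x0 is a fraction p / q of polynomials,
    so it has a pole of finite order at x.  A power of [ell x] strictly larger
    than this order turns p / q into a function that is 0 at x, which is the
    value there of the product on the left, where [ell x] is 0. *)
Lemma clear_pole g x0 x : wreg 0 g x0 -> exists N0, forall N w h, (N0 <= N)%N ->
  wreg w h x -> wreg (N%:Z + w) (fun y => ell x y ^+ N * h y * g y) x.
Proof.
move=> [V [d [e [p [q [oV Vx0 [sp sq] de H]]]]]].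
have q0 : q != 0.
  by have [+ _] := H _ Vx0; apply: contraNneq => ->; rewrite form_val0.
have [r [e' [q' [eE sq' q'x qE]]]] := form_order x q0 sq.
exists r.+1 => N w h rN wh.
pose f y := ell x y ^+ (N - r) * h y * (form_val d p y / form_val e' q' y).
apply: (@wreg_eq _ _ (V `|` [set x]) f).
- by apply: zopenU1 => //; exists x0.
- by right.
- move=> y Vy; rewrite /f; have [->|xy] := eqVneq x y.
    have /eqP -> : ell y y == 0 by rewrite ell_eq0.
    by rewrite !expr0n subn_eq0 leqNgt rN gtn_eqF ?mul0r //; apply: leq_trans rN.
  have l0 : ell x y != 0 by rewrite ell_eq0.
  case: Vy => [Vy|/= xE]; last by rewrite xE eqxx in xy.
  have [qy ->] := H _ Vy; rewrite qE.
  rewrite -[in RHS](subnK (ltnW rN)) exprD invfM.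
  have lr : ell x y ^+ r != 0 by rewrite expf_neq0.
  have E (a b c s t : F) : s != 0 -> a * s * b * (c * (s^-1 * t)) = a * b * (c * t).
    by move=> s0; rewrite (mulrAC a) -!mulrA; congr (_ * (_ * _)); rewrite mulrCA mulVKf.
  by rewrite E.
- have := wregM (wregM (wregX (N - r) (wreg_ell x x)) wh)
    (wregM (wreg_form x sp) (wregV (wreg_form x sq') q'x)).
  by rewrite /f; congr (wreg _ _ x); rewrite natz; lia.
Qed.

Lemma uniform_bound (T : eqType) (s : seq T) (P : T -> nat -> Prop) :
  (forall t N N', (N <= N')%N -> P t N -> P t N') ->
  (forall t, t \in s -> exists N, P t N) -> exists N, forall t, t \in s -> P t N.
Proof.
move=> mP; elim: s => [|t s IH] exP; first by exists 0%N.
have [N PN] : exists N, forall t, t \in s -> P t N.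
  by apply: IH => z zs; apply: exP; rewrite in_cons zs orbT.
have [N' PN'] := exP t (mem_head _ _).
exists (maxn N N') => z; rewrite in_cons => /orP[/eqP ->|/PN].
- by apply: mP PN'; exact: leq_maxr.
- by apply: mP; exact: leq_maxl.
Qed.

(** D is a large power of the product of the linear forms of the missing
    points; as D is 0 off V, the products D * g are extended by zero. *)
Lemma clear_poles V (I : finType) (g : P1 F -> I -> P1 F -> F) :
  zopen V -> V !=set0 ->
  (forall x i, ~ V x -> exists x0, wreg 0 (g x i) x0) ->
  exists (M : int) (D : P1 F -> F), [/\ forall x, wreg M D x,
    forall x, V x <-> D x != 0 &
    forall x i, ~ V x -> wreg M (fun y => D y * g x i y) x].
Proof.
move=> oV V0 gV.
have : finite_set (~` V) by case: oV V0 => [->[]|].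
move=> /finite_seqP[s0 sE0]; pose s := undup s0.
have us : uniq s by exact: undup_uniq.
have sE x : x \in s <-> ~ V x.
  by rewrite mem_undup; have := congr1 (fun A : set (P1 F) => A x) sE0 => /= ->.
pose P (xi : P1 F * I) (N0 : nat) := forall N w h, (N0 <= N)%N ->
  wreg w h xi.1 -> wreg (N%:Z + w) (fun y => ell xi.1 y ^+ N * h y * g xi.1 xi.2 y) xi.1.
have [N0 NP] : exists N, forall xi, xi \in [seq (x, i) | x <- s, i <- enum I] -> P xi N.
  apply: uniform_bound.
    by move=> xi N N' NN' PN L w h NL; apply: PN; exact: leq_trans NL.
  move=> xi /allpairsP[[x i] [/= /sE xs _ ->]].
  have [x0 wx0] := gV x i xs; exact: clear_pole wx0.
pose N := N0.+1.
exists (\sum_(b <- s) N%:Z), (fun y => \prod_(b <- s) ell b y ^+ N).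
have wl b x : wreg N%:Z (fun y => ell b y ^+ N) x.
  by have := wregX N (wreg_ell b x); rewrite natz.
split.
- by move=> x; apply: wreg_prod.
- move=> x; rewrite prodf_seq_neq0; split.
    move=> Vx; apply/allP => b /sE bs /=; rewrite expf_eq0 /= ell_eq0.
    by apply/eqP => bx; apply: bs; rewrite bx.
  move=> /allP H; apply: contrapT => /sE /H /=.
  by rewrite expf_eq0 /= ell_eq0 eqxx.
- move=> x i /sE xs; rewrite (big_rem x xs) /=.
  have wr := wreg_prod (rem x s) (wl^~ x).
  have /(NP _)/(_ N _ _ (leqnSn _) wr) : (x, i) \in [seq (x, i) | x <- s, i <- enum I].
    by apply: allpairs_f => //; rewrite mem_enum.
  by apply: wreg_ext => y /=; rewrite [in RHS](big_rem x xs).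
Qed.

End ClearingPoles.

(** * Sections and frames of bundles *)

Section LinearMaps.
Variables (K : pzRingType) (U V : lmodType K) (f : U -> V).
Hypothesis f_lin : linear f.
Local Open Scope ring_scope.

Lemma lin0 : f 0 = 0.
Proof. by have := f_lin (-1) 0 0; rewrite scaler0 addr0 scaleN1r addNr. Qed.

Lemma linD u v : f (u + v) = f u + f v.
Proof. by have := f_lin 1 u v; rewrite !scale1r. Qed.

Lemma linZ a u : f (a *: u) = a *: f u.
Proof. by have := f_lin a u 0; rewrite lin0 !addr0. Qed.

Lemma lin_sum (I : Type) (r : seq I) (h : I -> U) :
  f (\sum_(i <- r) h i) = \sum_(i <- r) f (h i).
Proof.
elim: r => [|i r IH]; first by rewrite !big_nil lin0.
by rewrite !big_cons linD IH.
Qed.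

End LinearMaps.

Section Frames.
Variable F : closedFieldType.
Local Open Scope classical_set_scope.
Local Open Scope ring_scope.
Implicit Types (E : bundle F) (V W : set (P1 F)) (x y : P1 F).

Definition coords E m (s : 'I_m -> forall x, fib E x) (i : chart E) (y : P1 F) :
    'M[F]_(m, rank E) := \matrix_(r < m) triv i (s r y).

Lemma coords_comb E m (s : 'I_m -> forall x, fib E x) (i : chart E) y (c : 'rV_m) :
  dom i y -> triv i (\sum_r c 0 r *: s r y) = c *m coords s i y.
Proof.
move=> iy; rewrite (lin_sum (triv_linear iy)) mulmx_sum_row; apply: eq_bigr => r _.
by rewrite (linZ (triv_linear iy)) rowK.
Qed.

Lemma transition E (i j : chart E) : exists G : P1 F -> 'M[F]_(rank E),
  (forall x, dom i x -> dom j x -> wmx (fun=> 0) (fun=> 0) G x) /\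
  (forall x (v : fib E x), dom i x -> dom j x -> triv j v = triv i v *m G x).
Proof.
have [G rG GP] := triv_trans i j; exists G; split=> // x ix jx r s.
by rewrite addr0; apply: (@regular_wreg _ (dom i `&` dom j)); exact: rG.
Qed.

Lemma coords_trans E m (s : 'I_m -> forall x, fib E x) (i j : chart E)
    (G : P1 F -> 'M[F]_(rank E)) y :
  (forall x (v : fib E x), dom i x -> dom j x -> triv j v = triv i v *m G x) ->
  dom i y -> dom j y -> coords s j y = coords s i y *m G y.
Proof.
by move=> GP iy jy; apply/row_matrixP => r; rewrite row_mul !rowK GP.
Qed.

Lemma wmx_coords_chart E m (k : 'I_m -> int) (s : 'I_m -> forall x, fib E x)
    (i j : chart E) x : dom i x -> dom j x ->
  wmx k (fun=> 0) (coords s i) x -> wmx k (fun=> 0) (coords s j) x.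
Proof.
move=> ix jx wi; have [G [wG GP]] := transition i j.
apply: (@wmx_eq _ _ _ _ _ (dom i `&` dom j) (fun y => coords s i y *m G y)) => //.
- by apply: zopenI; exact: dom_open.
- by move=> y [iy jy]; rewrite (coords_trans _ GP).
- apply: (wmxM _ wi (wG _ ix jx)) => r; by rewrite oppr0.
Qed.

(** Sections of E twisted by O(w), equivalently morphisms O(- w) -> E: the
    value at x is the image of 1 in the fibre of O(- w), which is the field. *)
Definition wsec E (w : int) (s : forall x, fib E x) : Prop :=
  forall x, exists i, dom i x /\ forall r, wreg w (fun y => triv i (s y) 0 r) x.

Lemma wsec_coords E m (k : 'I_m -> int) (s : 'I_m -> forall x, fib E x) :
  (forall r, wsec (k r) (s r)) ->
  forall (i : chart E) x, dom i x -> wmx k (fun=> 0) (coords s i) x.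
Proof.
move=> ws i x ix r; have [j [jx wj]] := ws r x.
have w1 : wmx (fun _ : 'I_1 => k r) (fun=> 0) (coords (fun=> s r) j) x.
  move=> r' l; rewrite addr0; apply: wreg_ext (wj l) => y.
  by rewrite mxE.
move=> l; have := wmx_coords_chart jx ix w1 ord0 l.
by apply: wreg_ext => y; rewrite !mxE.
Qed.

Definition indep E m (s : 'I_m -> forall x, fib E x) x : Prop :=
  forall c : 'rV[F]_m, \sum_r c 0 r *: s r x = 0 -> c = 0.

Lemma indep_unit E (s : 'I_(rank E) -> forall x, fib E x) (i : chart E) x :
  dom i x -> indep s x -> coords s i x \in unitmx.
Proof.
move=> ix si; rewrite unitmxE unitfE; apply/negP => /det0P[c /eqP c0 cs]; apply: c0.
apply: si; apply: (bij_inj (triv_bij ix)).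
by rewrite coords_comb // cs (lin0 (triv_linear ix)).
Qed.

(** A splitting of E into the line bundles O(k r): morphisms O(k r) -> E that
    together form an isomorphism on every fibre. *)
Definition frame E (k : 'I_(rank E) -> int) (s : 'I_(rank E) -> forall x, fib E x) :
    Prop :=
  forall x, exists i, [/\ dom i x, wmx (fun r => - k r) (fun=> 0) (coords s i) x &
    coords s i x \in unitmx].

Lemma frame_chart E k (s : 'I_(rank E) -> forall x, fib E x) : frame k s ->
  forall (i : chart E) x, dom i x ->
    wmx (fun r => - k r) (fun=> 0) (coords s i) x /\ coords s i x \in unitmx.
Proof.
move=> fs i x ix; have [j [jx wj uj]] := fs x; split.
  exact: wmx_coords_chart wj.
have [G [_ GP]] := transition i j.
move: uj; rewrite (coords_trans _ GP) // unitmx_mul => /andP[]; by [].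
Qed.

(** Off x the quotient is forced; at x its value is read off, in one chart, from
    the quotients of the coordinate functions. *)
Lemma wsec_div_ell E w (s : forall x, fib E x) x : wsec w s -> s x = 0 ->
  exists s', wsec (w - 1) s' /\ forall y, s y = ell x y *: s' y.
Proof.
move=> ws sx; have [i [ix wi]] := ws x.
have gP r : exists g, wreg (w - 1) g x /\ exists V,
    [/\ zopen V, V x & forall y, V y -> triv i (s y) 0 r = ell x y * g y].
  have [|g [wg VP]] := wreg_div_ell (wi r); last by exists g.
  by rewrite sx (lin0 (triv_linear ix)) mxE.
have [g {}gP] := choice gP.
have [h _ hK] := triv_bij ix.
pose v : fib E x := h (\row_r g r x).
have s'P y : exists u : fib E y, s y = ell x y *: u /\ (y = x -> triv i u = \row_r g r y).
  have [xy|xy] := eqVneq x y.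
    move: (s) sx; rewrite -xy => s1 s1x; exists v; split.
      rewrite s1x; have /eqP -> : ell x x == 0 by rewrite ell_eq0.
      by rewrite scale0r.
    by rewrite hK.
  exists ((ell x y)^-1 *: s y); split; last by move=> yx; rewrite yx eqxx in xy.
  by rewrite scalerA divff ?scale1r // ell_eq0.
pose s' y := projT1 (cid (s'P y)).
have s'E y : s y = ell x y *: s' y by exact: (projT2 (cid (s'P y))).1.
have s'x : triv i (s' x) = \row_r g r x by exact: (projT2 (cid (s'P x))).2.
exists s'; split => // z; have [<-|xz] := eqVneq x z.
  exists i; split => // r; have [wg [V [oV Vx VP]]] := gP r.
  apply: (@wreg_eq _ _ (dom i `&` V) (g r)) => //.
  - by apply: zopenI => //; exact: dom_open.
  - move=> y [iy /VP]; have [<- _|xy] := eqVneq x y; first by rewrite s'x mxE.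
    rewrite s'E (linZ (triv_linear iy)) mxE => /mulfI -> //.
    by rewrite ell_eq0.
have [j [jz wj]] := ws z; exists j; split => // r.
have lz : ell x z != 0 by rewrite ell_eq0.
have := wregM (wj r) (wregV (wreg_ell x z) lz).
have [V [oV Vz lV]] := wreg_near_neq0 (wreg_ell x z) lz.
apply: (@wreg_eq _ _ (V `&` dom j)) => //.
- by apply: zopenI => //; exact: dom_open.
- move=> y [/lV ly jy]; rewrite s'E (linZ (triv_linear jy)) mxE.
  by rewrite mulrAC divff ?mul1r.
Qed.

Lemma wsec_comb E m (w : int) (k : 'I_m -> int) (a : 'I_m -> P1 F -> F)
    (s : 'I_m -> forall x, fib E x) :
  (forall r, wsec (k r) (s r)) -> (forall r x, wreg (w - k r) (a r) x) ->
  wsec w (fun y => \sum_r a r y *: s r y).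
Proof.
move=> ws wa x; have [i ix] := dom_cover E x; exists i; split => // l.
apply: (@wreg_eq _ _ (dom i) (fun y => \sum_r a r y * coords s i y r l)) => //.
- exact: dom_open.
- move=> y iy; rewrite (lin_sum (triv_linear iy)) summxE.
  by apply: eq_bigr => r _; rewrite (linZ (triv_linear iy)) !mxE.
- apply: wreg_sum => r _; have := wregM (wa r x) (wsec_coords ws ix r l).
  by rewrite addr0 subrK.
Qed.

(** Multiplication by D turns the passages between c and the other charts into
    morphisms defined everywhere: D * G is E -> O(M)^n and D * H is
    O(- M)^n -> E, both isomorphisms over the domain of c and zero off it. *)
Definition clears_denominators E (c : chart E) (M : int) (D : P1 F -> F) : Prop :=
  (forall x, dom c x <-> D x != 0) /\
  forall x, exists i, dom i x /\ exists G H : P1 F -> 'M[F]_(rank E),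
    [/\ forall y (v : fib E y), dom i y -> dom c y -> triv c v = triv i v *m G y,
        forall y (v : fib E y), dom i y -> dom c y -> triv i v = triv c v *m H y,
        wmx (fun=> 0) (fun=> M) (fun y => D y *: G y) x &
        wmx (fun=> 0) (fun=> M) (fun y => D y *: H y) x].

Lemma exists_clearing E (c : chart E) : dom c !=set0 ->
  exists M D, clears_denominators c M D.
Proof.
move=> c0; have [i iP] := choice (@dom_cover F E).
have /choice[G GP] x := transition (i x) c.
have /choice[H HP] x := transition c (i x).
pose g x (t : bool * 'I_(rank E) * 'I_(rank E)) y :=
  if t.1.1 then G x y t.1.2 t.2 else H x y t.1.2 t.2.
have [|M [D [wD Dc gD]]] := @clear_poles F (dom c) _ g (dom_open c) c0.
  move=> x [[b r] l] _.
  have ix0 : dom (i x) !=set0 by exists x; exact: iP.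
  have [z [iz cz]] := zopen_meet (dom_open (i x)) (dom_open c) ix0 c0.
  exists z; case: b; rewrite /g /=.
  - by have := (GP x).1 z iz cz r l; rewrite addr0.
  - by have := (HP x).1 z cz iz r l; rewrite addr0.
exists M, D; split => // x; have [cx|cx] := pselect (dom c x).
  exists c; split => //; exists (fun=> 1%:M), (fun=> 1%:M).
  have w1 : wmx (fun=> 0) (fun=> M) (fun y => D y *: 1%:M : 'M[F]_(rank E)) x.
    move=> r l; rewrite addrC;
    apply: (@wreg_ext _ _ (fun y => D y * (1%:M : 'M[F]_(rank E)) r l)).
      by move=> y; rewrite [RHS]mxE.
    by apply: wregM => //; exact: wreg_cst.
  by split => // y v _ _; rewrite mulmx1.
exists (i x); split; first exact: iP.
exists (G x), (H x); split.
- exact: (GP x).2.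
- by move=> y v iy cy; exact: (HP x).2.
- move=> r l; rewrite add0r; apply: wreg_ext (gD x (true, r, l) cx) => y.
  by rewrite !mxE.
- move=> r l; rewrite add0r; apply: wreg_ext (gD x (false, r, l) cx) => y.
  by rewrite !mxE.
Qed.

Section Grothendieck.
Variable E : bundle F.
Variables (c : chart E) (x0 : P1 F) (M : int) (D : P1 F -> F).
Hypotheses (cx0 : dom c x0) (cD : clears_denominators c M D).
Local Notation n := (rank E).
Implicit Types (k : 'I_n -> int) (s : 'I_n -> forall x, fib E x).

Lemma clearing_eq0 y : ~ dom c y -> D y = 0.
Proof. by move=> cy; apply/eqP/negPn/negP => /cD.1. Qed.

(** The basis of chart c multiplied by D, extended by zero. *)
Lemma initial_sections : exists k s,
  (forall r, wsec (- k r) (s r)) /\ indep s x0.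
Proof.
have gP y : exists g : 'rV[F]_n -> fib E y, dom c y -> cancel g (triv c (x := y)).
  have [cy|cy] := pselect (dom c y); last by exists (fun=> 0).
  by have [g _ gK] := triv_bij cy; exists g.
pose g y := projT1 (cid (gP y)).
have gK y : dom c y -> cancel (g y) (triv c (x := y)) by exact: (projT2 (cid (gP y))).
pose s (r : 'I_n) y := D y *: g y (delta_mx 0 r).
exists (fun=> - M), s; split.
  move=> r x; have [i [ix [_ [H [_ HP _ wH]]]]] := cD.2 x.
  exists i; split => // l; have := wH r l; rewrite add0r opprK.
  apply: (wreg_eq (dom_open i) ix) => y iy.
  rewrite (linZ (triv_linear iy)) !mxE.
  have [cy|/clearing_eq0 ->] := pselect (dom c y); last by rewrite !mul0r.
  by rewrite (HP _ _ iy cy) gK // -rowE mxE.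
move=> v /(congr1 (triv c (x := x0))).
rewrite coords_comb // (lin0 (triv_linear cx0)) => vs.
have Dx0 : D x0 != 0 by exact/cD.1.
have cE : coords s c x0 = (D x0)%:M.
  apply/row_matrixP => r; rewrite rowK (linZ (triv_linear cx0)) gK //.
  by rewrite rowE mul_mx_scalar.
by move: vs; rewrite cE mul_mx_scalar => /eqP; rewrite scaler_eq0 (negbTE Dx0) => /eqP.
Qed.

(** The composite of the morphism given by the s_r with E -> O(M)^n is a square
    matrix of global functions, whose determinant is not 0 at x0. *)
Lemma degree_bound k s : (forall r, wsec (- k r) (s r)) -> indep s x0 ->
  \sum_r k r <= M *+ n.
Proof.
move=> ws si.
suff : 0 <= \sum_r (- k r) + \sum_(r < n) M.
  by rewrite sumrN addrC subr_ge0 sumr_const card_ord.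
apply: (@liouville F _ (fun y => \det (D y *: coords s c y)) x0); last first.
  have := indep_unit cx0 si; rewrite unitmxE unitfE => d0.
  by rewrite detZ mulf_neq0 ?expf_neq0 //; exact/cD.1.
move=> x; apply: wmx_det.
have [i [ix [G [_ [GP _ wG _]]]]] := cD.2 x.
apply: (@wmx_eq _ _ _ _ _ (dom i) (fun y => coords s i y *m (D y *: G y))) => //.
- exact: dom_open.
- move=> y iy; rewrite -scalemxAr.
  have [cy|/clearing_eq0 ->] := pselect (dom c y); last by rewrite !scale0r.
  by rewrite -(coords_trans _ GP).
- by apply: (wmxM _ (wsec_coords ws ix) wG) => r; rewrite oppr0.
Qed.

(** A relation at x between sections is a section that vanishes at x, hence a
    multiple of [ell x]; dividing raises the degree of the section it
    replaces. *)
Lemma raise_degree k s x : (forall r, wsec (- k r) (s r)) -> indep s x0 ->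
  ~ indep s x -> exists k' s', [/\ forall r, wsec (- k' r) (s' r), indep s' x0 &
    \sum_r k' r = \sum_r k r + 1].
Proof.
move=> ws s0 sx.
have xx0 : x != x0 by apply/eqP => xx0; apply: sx; rewrite xx0.
have [v [vs v0]] : exists v : 'rV[F]_n, \sum_r v 0 r *: s r x = 0 /\ v <> 0.
  apply: contrapT => H; apply: sx => v vs; apply: contrapT => v0.
  by apply: H; exists v.
have [r0 vr0] : exists r, v 0 r != 0.
  apply/existsP; apply: contra_notT v0; rewrite negb_exists => /forallP H.
  by apply/rowP => r; rewrite mxE; apply/eqP; rewrite -[_ == _]negbK.
case: (@arg_minP _ _ _ r0 (fun r => v 0 r != 0) k vr0) => i vi kmin.
(* k i is minimal, so the exponents are k r - k i >= 0 wherever v 0 r != 0. *)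
pose a r y := v 0 r * lunit x y ^+ `|k r - k i|%N.
pose t y := \sum_r a r y *: s r y.
have wt : wsec (- k i) t.
  apply: wsec_comb ws _ => r z; rewrite opprK /a.
  have [->|vr] := eqVneq (v 0 r) 0.
    by apply: (@wreg_ext _ _ (fun=> 0)); [move=> y; rewrite mul0r | exact: wreg0].
  rewrite -[X in wreg X]add0r; apply: wregM; first exact: wreg_cst.
  have := wregX `|k r - k i|%N (wreg_lunit x z); congr (wreg _ _ z).
  by rewrite natz; have := kmin _ vr; lia.
have tx : t x = 0.
  by rewrite -[RHS]vs; apply: eq_bigr => r _; rewrite /a lunit1 expr1n mulr1.
have [t' [wt' tE]] := wsec_div_ell wt tx.
pose k' r := if r == i then k i + 1 else k r.
pose s' r y := if r == i then t' y else s r y.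
exists k', s'; split.
- move=> r; rewrite /k' /s'; case: eqP => // _.
  by move: wt'; rewrite opprD.
- move=> u; rewrite (bigD1 i) //= => us.
  have l0 : ell x x0 != 0 by rewrite ell_eq0.
  have t'E : t' x0 = (ell x x0)^-1 *: t x0 by rewrite tE scalerK.
  (* A relation between the new sections at x0, rewritten in the old ones. *)
  pose b : 'rV[F]_n :=
    \row_r (u 0 i * (ell x x0)^-1 * a r x0 + (if r == i then 0 else u 0 r)).
  have /s0 b0 : \sum_r b 0 r *: s r x0 = 0.
    rewrite -[RHS]us /s' eqxx t'E.
    under [LHS]eq_bigr => r _ do rewrite mxE scalerDl -scalerA.
    rewrite big_split /= -scaler_sumr -/(t x0) scalerA; congr (_ + _).
    rewrite (bigD1 i) //= eqxx scale0r add0r; apply: eq_bigr => r /negbTE ->.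
    by [].
  have ui : u 0 i = 0.
    have /rowP/(_ i)/eqP := b0; rewrite !mxE eqxx addr0 /a subrr expr0 mulr1.
    by rewrite !mulf_eq0 invr_eq0 (negbTE l0) (negbTE vi) !orbF => /eqP.
  apply/rowP => r; have /rowP/(_ r) := b0; rewrite !mxE ui !mul0r add0r.
  by case: eqP => // ->.
- rewrite (bigD1 i) //= [in RHS](bigD1 i) //= {1}/k' eqxx addrAC; congr (_ + _ + _).
  by apply: eq_bigr => r /negbTE ri; rewrite /k' ri.
Qed.

(** Induction on the distance of the sum of the degrees to its bound. *)
Lemma exists_frame_from_chart : exists k s, frame k s.
Proof.
have [k [s [ws s0]]] := initial_sections.
have [N] := ubnP (absz (M *+ n - \sum_r k r)%R);
elim: N k s ws s0 => // N IH k s ws s0 kN.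
have [si|/existsNP[x sx]] := pselect (forall x, indep s x).
  exists k, s => x; have [i ix] := dom_cover E x; exists i; split => //.
  - exact: wsec_coords ws _ _ ix.
  - exact: indep_unit.
have [k' [s' [ws' s0' kE]]] := raise_degree ws s0 sx.
apply: (IH k' s') => //; move: kN; rewrite kE.
have := degree_bound ws' s0'; rewrite kE; lia.
Qed.

End Grothendieck.

(** Grothendieck's theorem: every bundle on the projective line is a direct sum
    of line bundles O(k). *)
Theorem exists_frame E : exists k s, @frame E k s.
Proof.
have [c cx0] := dom_cover E None.
have [|M [D cD]] := @exists_clearing E c; first by exists None.
exact: exists_frame_from_chart cx0 cD.
Qed.

End Frames.

(** * Morphisms between framed bundles *)

Section FrameMaps.
Variable F : closedFieldType.
Local Open Scope classical_set_scope.
Local Open Scope ring_scope.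
Implicit Types (E A B : bundle F) (x y : P1 F).

Lemma delta_comb (V : lmodType F) n (v : 'I_n -> V) r :
  \sum_l (delta_mx 0 r : 'rV[F]_n) 0 l *: v l = v r.
Proof.
rewrite (bigD1 r) //= mxE !eqxx scale1r big1 ?addr0 // => l lr.
by rewrite mxE eqxx /= (negbTE lr) scale0r.
Qed.

Lemma frame_wsec E k (s : 'I_(rank E) -> forall x, fib E x) : frame k s ->
  forall r, wsec (- k r) (s r).
Proof.
move=> fs r x; have [i [ix wi _]] := fs x; exists i; split => // l.
by have := wi r l; rewrite addr0; apply: wreg_ext => y; rewrite mxE.
Qed.

(** The coordinates in the frame do not depend on the chart in which they are
    computed; their regularity is that of the inverse matrix. *)
Lemma frame_coef E k (s : 'I_(rank E) -> forall x, fib E x) : frame k s ->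
  exists coef : forall x, fib E x -> 'rV[F]_(rank E), [/\
    forall x, linear (coef x),
    forall x v, v = \sum_r coef x v 0 r *: s r x &
    forall i x v, dom i x -> coef x v = triv i v *m invmx (coords s i x)].
Proof.
move=> fs; have [i iP] := choice (@dom_cover F E).
pose coef x (v : fib E x) := triv (i x) v *m invmx (coords s (i x) x).
have coefK x (v : fib E x) : v = \sum_r coef x v 0 r *: s r x.
  apply: (bij_inj (triv_bij (iP x))).
  by rewrite coords_comb // mulmxKV //; have [] := frame_chart fs (iP x).
exists coef; split => //.
- by move=> x a u v; rewrite /coef (triv_linear (iP x)) mulmxDl scalemxAl.
- move=> j x v jx; have [_ uj] := frame_chart fs jx.
  by rewrite [in RHS](coefK x v) coords_comb // mulmxK.
Qed.

Lemma frame_coef_comb E k (s : 'I_(rank E) -> forall x, fib E x)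
    (coef : forall x, fib E x -> 'rV[F]_(rank E)) : frame k s ->
  (forall i x v, dom i x -> coef x v = triv i v *m invmx (coords s i x)) ->
  forall x (c : 'rV_(rank E)), coef x (\sum_r c 0 r *: s r x) = c.
Proof.
move=> fs cE x c; have [i ix] := dom_cover E x; have [_ ui] := frame_chart fs ix.
by rewrite (cE i) // coords_comb // mulmxK.
Qed.

(** A bundle that is split by a frame maps to B as soon as each of its summands
    O(k r) does. *)
Lemma hom_of_sections A B k (s : 'I_(rank A) -> forall x, fib A x)
    (t : 'I_(rank A) -> forall x, fib B x) :
  frame k s -> (forall r, wsec (- k r) (t r)) ->
  exists h : bundle_hom A B, forall r x, hom_map h (s r x) = t r x.
Proof.
move=> fs wt; have [coef [coef_lin coefK coefE]] := frame_coef fs.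
pose h x (v : fib A x) : fib B x := \sum_r coef x v 0 r *: t r x.
have h_lin x : linear (h x).
  move=> a u v; rewrite /h scaler_sumr -big_split /=; apply: eq_bigr => r _.
  by rewrite coef_lin !mxE scalerDl scalerA.
have h_reg (i : chart A) (j : chart B) : exists2 G : P1 F -> 'M[F]_(rank A, rank B),
    regular_mx (dom i `&` dom j) G &
    forall x (v : fib A x), dom i x -> dom j x -> triv j (h x v) = triv i v *m G x.
  exists (fun x => invmx (coords s i x) *m coords t j x); last first.
    by move=> x v ix jx; rewrite coords_comb // mulmxA -coefE.
  move=> r l x [ix jx]; apply: wreg_regular => //.
    by apply: zopenI; exact: dom_open.
  have [wi ui] := frame_chart fs ix.
  have := wmxM _ (wmx_inv wi ui) (wsec_coords wt jx).
  move=> /(_ (fun=> esym (opprK _))) /(_ r l).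
  by rewrite oppr0 addr0.
exists (BundleHom h_lin h_reg) => r x /=; rewrite /h.
have -> : coef x (s r x) = delta_mx 0 r.
  by rewrite -(frame_coef_comb fs coefE x (delta_mx 0 r)) delta_comb.
by rewrite delta_comb.
Qed.

(** The (i, j) coefficient of h in the two frames is a global function of weight
    l j - k i, to which [liouville] applies; P is its value at x0. *)
Lemma hom_coef_matrix A B k (s : 'I_(rank A) -> forall x, fib A x)
    l (t : 'I_(rank B) -> forall x, fib B x) (h : bundle_hom A B) x0 :
  frame k s -> frame l t -> injective (hom_map h (x := x0)) ->
  exists P : 'M[F]_(rank A, rank B), row_free P /\
    forall i j, P i j != 0 -> k i <= l j.
Proof.
move=> fs ft hinj; have [coef [coef_lin coefK coefE]] := frame_coef ft.
pose P x : 'M[F]_(rank A, rank B) := \matrix_r coef x (hom_map h (s r x)).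
exists (P x0); split.
  apply: inj_row_free => v vP.
  have hv : hom_map h (\sum_r v 0 r *: s r x0) = 0.
    rewrite [LHS](coefK x0) big1 // => j _.
    suff -> : coef x0 (hom_map h (\sum_r v 0 r *: s r x0)) = v *m P x0.
      by rewrite vP mxE scale0r.
    rewrite (lin_sum (@hom_linear _ _ _ h x0)) (lin_sum (coef_lin x0)) mulmx_sum_row.
    apply: eq_bigr => r _.
    by rewrite (linZ (@hom_linear _ _ _ h x0)) (linZ (coef_lin x0)) rowK.
  have /hinj vs : hom_map h (\sum_r v 0 r *: s r x0) = hom_map h 0.
    by rewrite hv (lin0 (@hom_linear _ _ _ h x0)).
  have [i ix] := dom_cover A x0; have [_ ui] := frame_chart fs ix.
  have := congr1 (triv i (x := x0)) vs.
  rewrite coords_comb // (lin0 (triv_linear ix)).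
  move=> /(congr1 (mulmxr (invmx (coords s i x0)))).
  by rewrite /= mulmxK // mul0mx.
move=> i j Pij; rewrite -subr_ge0 addrC.
apply: (@liouville F _ (fun x => P x i j) x0) => // x.
have [c cx] := dom_cover A x; have [d dx] := dom_cover B x.
have [G rG GP] := hom_reg h c d.
have [ws _] := frame_chart fs cx; have [wt ut] := frame_chart ft dx.
have wG : wmx (fun=> 0) (fun=> 0) G x.
  by move=> r r'; rewrite addr0; apply: (@regular_wreg _ (dom c `&` dom d)); exact: rG.
have := wmxM (fun=> esym (oppr0 _)) (wmxM (fun=> esym (oppr0 _)) ws wG) (wmx_inv wt ut).
move=> /(_ i j); rewrite opprK; apply: (@wreg_eq _ _ (dom c `&` dom d)) => //.
  by apply: zopenI; exact: dom_open.
move=> y [cy dy]; rewrite [RHS]mxE (coefE d) // (GP _ _ cy dy).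
by rewrite -(rowK (fun r => triv c (s r y)) i) -!row_mul [RHS]mxE.
Qed.

Lemma triv_cast E (i : chart E) x y (e : x = y) (v : fib E x) :
  triv i (fib_cast e v) = triv i v.
Proof. by case: _ / e. Qed.

Lemma fib_castK E x y (e : x = y) (e' : y = x) (v : fib E x) :
  fib_cast e' (fib_cast e v) = v.
Proof. by move: e'; case: _ / e => e'; rewrite (Prop_irrelevance e' erefl). Qed.

(** A frame does not see along which factorization of a map a bundle is pulled
    back. *)
Lemma frame_cast (f g h : P1_morphism F) (e : forall x, f (g x) = h x) A k
    (s : 'I_(rank A) -> forall x, fib A (f (g x))) :
  @frame F (pullback g (pullback f A)) k s ->
  @frame F (pullback h A) k (fun r x => fib_cast (e x) (s r x)).
Proof.
move=> fs x; have [i [ix wi ui]] := fs x; exists i.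
have E : coords (E := pullback h A) (fun r x => fib_cast (e x) (s r x)) i =
    coords (E := pullback g (pullback f A)) s i.
  by apply/funext => y; apply/row_matrixP => r; rewrite !rowK;
    exact (@triv_cast A i _ _ (e y) (s r y)).
by rewrite E; split => //; move: ix; rewrite /= /preimage /= e.
Qed.

Lemma frame_cast_inv (f g h : P1_morphism F) (e : forall x, f (g x) = h x) A k
    (s : 'I_(rank A) -> forall x, fib A (h x)) :
  @frame F (pullback h A) k s ->
  @frame F (pullback g (pullback f A)) k (fun r x => fib_cast (esym (e x)) (s r x)).
Proof.
move=> fs x; have [i [ix wi ui]] := fs x; exists i.
have E : coords (E := pullback g (pullback f A))
      (fun r x => fib_cast (esym (e x)) (s r x)) i =
    coords (E := pullback h A) s i.
  by apply/funext => y; apply/row_matrixP => r; rewrite !rowK;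
    exact (@triv_cast A i _ _ (esym (e y)) (s r y)).
by rewrite E; split => //; move: ix; rewrite /= /preimage /= e.
Qed.

(** The pullback of O(k) under z = t ^ d is O(k d). *)
Lemma frame_pullback d E k (s : 'I_(rank E) -> forall x, fib E x) : (0 < d)%N ->
  frame k s ->
  @frame F (pullback (pow_morphism F d) E) (fun r => k r * d%:Z)
    (fun r x => s r (pow_fun d x)).
Proof.
move=> d0 fs x; have [i [ix wi ui]] := fs (pow_fun d x); exists i; split => //.
move=> r l; have := wreg_pow d0 (wi r l); rewrite !addr0 mulNr.
by apply: wreg_ext => y; rewrite /= !mxE.
Qed.

Lemma split_lshift m n (i : 'I_m) : split (lshift n i) = inl i.
Proof. exact: (unsplitK (inl i)). Qed.

Lemma split_rshift m n (i : 'I_n) : split (rshift m i) = inr i.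
Proof. exact: (unsplitK (inr i)). Qed.

Lemma frame_sum A B k (s : 'I_(rank A) -> forall x, fib A x)
    l (t : 'I_(rank B) -> forall x, fib B x) : frame k s -> frame l t ->
  @frame F (bundle_sum A B)
    (fun r => match split r with inl i => k i | inr j => l j end)
    (fun r x => match split r with inl i => (s i x, 0) | inr j => (0, t j x) end).
Proof.
move=> fs ft x; have [i [ix wi ui]] := fs x; have [j [jx wj uj]] := ft x.
exists (i, j).
set c := coords _ _.
have cE y : dom i y -> dom j y -> c y = block_mx (coords s i y) 0 0 (coords t j y).
  move=> iy jy; apply/row_matrixP => r; rewrite rowK.
  case: (split_ordP r) => r' ->; rewrite /block_mx.
  - rewrite rowKu row_row_mx rowK row0.
    by rewrite -(lin0 (triv_linear jy)).
  - rewrite rowKd row_row_mx rowK row0.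
    by rewrite -(lin0 (triv_linear iy)).
split => //; last by rewrite cE // unitmxE det_ublock unitrM -!unitmxE ui.
apply: (@wmx_eq _ _ _ _ _ (dom i `&` dom j)
  (fun y => block_mx (coords s i y) 0 0 (coords t j y))) => //.
- by apply: zopenI; exact: dom_open.
- by move=> y [iy jy]; rewrite cE.
- move=> r r'; case: (split_ordP r) => a ->; case: (split_ordP r') => b ->;
    rewrite ?split_lshift ?split_rshift.
  + by apply: wreg_ext (wi a b) => y; rewrite block_mxEul.
  + by apply: wreg_ext (wreg0 _ x) => y; rewrite block_mxEur mxE.
  + by apply: wreg_ext (wreg0 _ x) => y; rewrite block_mxEdl mxE.
  + by apply: wreg_ext (wj a b) => y; rewrite block_mxEdr.
Qed.

Lemma wreg_expz w f x (k : int) : wreg w f x -> f x != 0 ->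
  wreg (w * k) (fun y : P1 F => f y ^ k) x.
Proof.
move=> wf fx; case: k => n.
  by have := wregX n wf; rewrite -mulr_natr natz.
rewrite NegzE mulrN; have := wregV (wregX n.+1 wf) (expf_neq0 n.+1 fx).
by rewrite -mulr_natr natz.
Qed.

(** Near a point of chart b, the constant section 1 has coordinate u ^ (- k) with
    u the linear form that does not vanish on the chart: w on the finite part,
    z away from 0. *)
Lemma frame_line (k : int) :
  @frame F (line_bundle F k) (fun=> k) (fun _ x => (1 : F)).
Proof.
move=> x; have [b bx] := dom_cover (line_bundle F k) x; exists b.
have sb := line_scal_neq0 k bx.
split => //; last first.
  by rewrite unitmxE det_mx11 !mxE mulr1 unitfE.
move=> r l; rewrite addr0.
(* [Some 0] stands for any finite point: its [lunit] is the form w. *)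
pose u := lunit (if b then Some (0 : F) else None).
have uE y : line_dom b y -> u y != 0 /\ u y ^ (- k) = line_scal k b y.
  rewrite /u /lunit /line_dom; case: (b); case: y => [a|] //= ny.
  - by rewrite hornerC exp1rz oner_neq0.
  - by rewrite hornerX; split => //; apply/eqP => a0; apply: ny; rewrite a0.
  - by rewrite coefX /= exp1rz oner_neq0.
have := wreg_expz (- k) (wreg_lunit _ x) (uE x bx).1.
rewrite mul1r; apply: (@wreg_eq _ _ (line_dom b)) => //; first exact: line_dom_open.
by move=> y /uE[_ yE]; rewrite !mxE /= mulr1 yE.
Qed.

End FrameMaps.

(** * Uniqueness of the slopes *)

Section Slopes.
Variable F : closedFieldType.
Local Open Scope ring_scope.

(** Otherwise every term of the Leibniz expansion has a zero factor. *)
Lemma det_transversal n (P : 'M[F]_n) : P \in unitmx ->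
  exists s : 'S_n, forall i, P i (s i) != 0.
Proof.
rewrite unitmxE unitfE => P0; apply: contrapT => H; case/eqP: P0.
rewrite /determinant big1 // => s _.
have [i /negP] : exists i, ~ (P i (s i) != 0).
  apply: contrapT => Hs; apply: H; exists s => i.
  by apply: contrapT => Pi; apply: Hs; exists i.
by rewrite negbK => /eqP Pi; rewrite (bigD1 i) //= Pi mul0r mulr0.
Qed.

(** Transversals of nonzero entries give q_i <= q'_(s i) and q'_j <= q_(t j).
    Summing, the two totals are equal, so each inequality in the first family is
    an equality. *)
Lemma perm_eq_of_matrices m n (P : 'M[F]_(m, n)) (Q : 'M[F]_(n, m)) (q q' : seq rat) :
  size q = m -> size q' = n -> row_free P -> row_free Q ->
  (forall i j, P i j != 0 -> q`_i <= q'`_j) ->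
  (forall i j, Q i j != 0 -> q'`_i <= q`_j) -> perm_eq q q'.
Proof.
move=> sq sq' fP fQ PE QE.
have mn : m = n.
  apply/eqP; rewrite eqn_leq.
  by rewrite -{1}(eqP fP) rank_leq_col /= -{1}(eqP fQ) rank_leq_col.
move: sq' P Q fP fQ PE QE; case: n / mn => sq' P Q.
rewrite !row_free_unit => /det_transversal[s sP] /det_transversal[t tQ] PE QE.
have sumE (u : 'S_m) (r : seq rat) : \sum_(i < m) r`_(u i) = \sum_(i < m) r`_i.
  by rewrite [RHS](reindex_inj (@perm_inj _ u)).
have le1 : forall i : 'I_m, true -> 0 <= q'`_(s i) - q`_i.
  by move=> i _; rewrite subr_ge0 PE.
have s0 : \sum_(i < m) (q'`_(s i) - q`_i) = 0.
  apply/eqP; rewrite eq_le sumr_ge0 // andbT sumrB sumE subr_le0 -(sumE t q).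
  by apply: ler_sum => i _; exact: QE.
have qE (i : 'I_m) : q`_i = q'`_(s i) :> rat.
  by apply/eqP; rewrite eq_sym -subr_eq0; apply/eqP/(psumr_eq0P le1 s0).
have mapE (r : seq rat) : size r = m -> r = [seq r`_(nat_of_ord i) | i <- enum 'I_m].
  move=> sr; apply: (@eq_from_nth _ 0) => [|i im].
    by rewrite size_map size_enum_ord.
  by rewrite sr in im; rewrite (nth_map (Ordinal im)) ?size_enum_ord // nth_enum_ord.
rewrite (mapE q sq) (mapE q' sq').
under eq_map => i do rewrite qE.
rewrite (map_comp (fun i : 'I_m => q'`_i) s); apply: perm_map.
apply: uniq_perm; [|exact: enum_uniq|].
  by rewrite map_inj_uniq ?enum_uniq //; exact: perm_inj.
move=> i; rewrite mem_enum inE; apply/mapP; exists (s^-1%g i); first by rewrite mem_enum.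
by rewrite permKV.
Qed.

End Slopes.

(** * Splittings in the colimit category *)

Section Proalgebraic.
Variable F : closedFieldType.
Local Open Scope classical_set_scope.
Local Open Scope ring_scope.
Implicit Types (A B C : proalg F) (q : seq rat) (x y : P1 F).

(** On P1_L, O(a) has degree a L; in particular a L is an integer here. *)
Definition splits_at A q (L : nat) : Prop :=
  exists (k : 'I_(rank (rep_at A L)) -> int) s,
    (forall r, (k r)%:Q = q`_r * L%:Q) /\ @frame F (rep_at A L) k s.

Definition splits A q : Prop := size q = proalg_rank A /\
  exists L : nat, [/\ (0 < L)%N, (level A %| L)%N & splits_at A q L].

Lemma splits_at_dvd A q L L' : (0 < L)%N -> (0 < L')%N -> (level A %| L)%N ->
  (L %| L')%N -> splits_at A q L -> splits_at A q L'.
Proof.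
move=> L0 L'0 AL LL' [k [s [kE fs]]].
have d0 : (0 < L' %/ L)%N by rewrite divn_gt0 // dvdn_leq.
have fp := frame_pullback d0 fs.
have e x : rho F L (level A) (rho F L' L x) = rho F L' (level A) x.
  exact: rho_comp (level_gt0 A) L0 AL LL'.
exists (fun r => k r * (L' %/ L)%:Z); eexists; split; last exact: (frame_cast e fp).
move=> r; rewrite intrM kE -mulrA -[in RHS](divnK LL') PoszM intrM; congr (_ * _).
by rewrite mulrC.
Qed.

Lemma exists_splits A : exists q, splits A q.
Proof.
have [k [s fs]] := exists_frame (rep_at A (level A)).
have lA : (level A)%:Q != 0 by rewrite intr_eq0 -lt0n level_gt0.
exists [seq (k r)%:Q / (level A)%:Q | r <- enum 'I_(rank (rep_at A (level A)))]; split.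
  by rewrite size_map size_enum_ord.
exists (level A); split; rewrite ?level_gt0 //.
exists k, s; split => // r.
by rewrite (nth_map r) ?size_enum_ord // nth_ord_enum divfK.
Qed.

(** The representative of O(a) is O(numq a) on P1_(denq a), and
    numq a = a * denq a. *)
Lemma splits_line (a : rat) : splits (line_proalg F a) [:: a].
Proof.
split => //; exists `|denq a|%N; split => //; first exact: denq_abs_gt0.
have d0 : (0 < `|denq a| %/ `|denq a|)%N by rewrite divnn denq_abs_gt0.
have := frame_pullback d0 (@frame_line F (numq a)).
eexists; eexists; split; last by eassumption.
move=> r; rewrite ord1 /= divnn denq_abs_gt0 mulr1 absz_denq.
by rewrite -{2}(divq_num_den a) divfK // intr_eq0 denq_neq0.
Qed.

Lemma splits0 : splits (proalg0 F) [::].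
Proof.
split => //; exists 1%N; split => //.
exists (fun=> 0), (fun _ _ => 0); split => [r|x]; first by case: r.
exists tt; split => //; first by case.
by rewrite unitmxE det_mx00 unitr1.
Qed.

(** Over a common multiple N of the two levels both frames live on the same
    line; they only have to be transported along the factorization of the
    pullbacks through the level of the sum. *)
Lemma splits_sum A B q q' : splits A q -> splits B q' ->
  splits (proalg_sum A B) (q ++ q').
Proof.
move=> [sq [L [L0 AL Aq]]] [sq' [L' [L'0 BL' Bq']]].
split; first by rewrite size_cat sq sq'.
pose N := lcmn L L'; pose m := lcmn (level A) (level B).
have N0 : (0 < N)%N by rewrite lcmn_gt0 L0.
have mN : (m %| N)%N.
  by rewrite dvdn_lcm !(dvdn_trans AL, dvdn_trans BL') ?dvdn_lcml ?dvdn_lcmr.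
exists N; split => //.
have [k [s [kE fs]]] := splits_at_dvd L0 N0 AL (dvdn_lcml _ _) Aq.
have [l [t [lE ft]]] := splits_at_dvd L'0 N0 BL' (dvdn_lcmr _ _) Bq'.
have eA x : rho F m (level A) (rho F N m x) = rho F N (level A) x.
  exact: rho_comp (level_gt0 A) (level_lcm_gt0 A B) (dvdn_lcml _ _) mN.
have eB x : rho F m (level B) (rho F N m x) = rho F N (level B) x.
  exact: rho_comp (level_gt0 B) (level_lcm_gt0 A B) (dvdn_lcmr _ _) mN.
have fst := frame_sum (frame_cast_inv eA fs) (frame_cast_inv eB ft).
eexists; eexists; split; last exact: fst.
move=> r /=; rewrite nth_cat sq; case: splitP => i rE /=.
- by rewrite rE kE.
- have -> : (r - proalg_rank A)%N = i by exact: etrans (congr1 (subn^~ _) rE) (addKn _ _).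
  exact: lE.
Qed.

Lemma splits_big_sum q :
  splits (\big[@proalg_sum F/proalg0 F]_(a <- q) line_proalg F a) q.
Proof.
elim: q => [|a q IH]; first by rewrite big_nil; exact: splits0.
by rewrite big_cons -cat1s; apply: splits_sum => //; exact: splits_line.
Qed.

Lemma fib_cast_inj (E : bundle F) x y (e : x = y) : injective (@fib_cast F E x y e).
Proof.
by apply: (can_inj (g := fib_cast (esym e))) => v; exact: fib_castK.
Qed.

(** On P1_L the composite is the identity and, up to the canonical
    identifications of fibres, it applies [hrep f] first, at the image of the
    point on P1_(hlevel f).  For L' above L, the projection from P1_L' to
    P1_(hlevel f) factors through P1_L. *)
Lemma hom_at_inj A B (f : proalg_hom A B) (g : proalg_hom B A) :
  proalg_hom_eq (proalg_comp f g) (proalg_id A) ->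
  exists L : nat, [/\ (0 < L)%N, (hlevel f %| L)%N &
    forall L' (d : (hlevel f %| L')%N) x, (0 < L')%N -> (L %| L')%N ->
      injective (hom_map (hom_at d) (x := x))].
Proof.
move=> [L [L0 [d1 [d2 E]]]]; exists L; split => //.
  exact: dvdn_trans (dvdn_lcml _ _) d1.
move=> L' d x L'0 LL'.
pose m := lcmn (hlevel f) (hlevel g).
have m0 : (0 < m)%N by exact: hlevel_lcm_gt0.
have xE : rho F m (hlevel f) (rho F L m (rho F L' L x)) = rho F L' (hlevel f) x.
  rewrite (rho_comp _ (hlevel_gt0 f) m0 (dvdn_lcml _ _) d1).
  by rewrite (rho_comp _ (hlevel_gt0 f) L0 (dvdn_trans (dvdn_lcml _ _) d1) LL').
pose z := rho F L' L x.
have fz : injective (hom_map (hrep f) (x := rho F m (hlevel f) (rho F L m z))).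
  move=> u v uv.
  pose eA := rho_comp (rho F L m z) (level_gt0 A) (hlevel_gt0 f) (hlevel_src f)
    (dvdn_lcml _ (hlevel g)).
  pose eL := rho_comp z (level_gt0 A) (hlevel_gt0 (proalg_comp f g))
    (hlevel_src (proalg_comp f g)) d1.
  pose w t : fib (rep_at A L) z :=
    @fib_cast F (rep A) _ _ eL (@fib_cast F (rep A) _ _ eA t).
  pose castA t := @fib_cast F (rep A) _ _ (esym eA)
    (@fib_cast F (rep A) _ _ (esym eL) t).
  have wK t : castA (w t) = t by rewrite /castA /w !fib_castK.
  suff wuv : w u = w v by rewrite -(wK u) wuv wK.
  have : hom_map (hom_at d1) (w u) = hom_map (hom_at d1) (w v).
    (* K is what the composite does after [hrep f]. *)
    pose K t := @fib_cast F (rep A) _ _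
      (rho_comp z (level_gt0 A) (hlevel_gt0 (proalg_comp f g))
        (hlevel_tgt (proalg_comp f g)) d1)
      (hom_map (hom_at (dvdn_lcmr (hlevel f) (hlevel g)))
        (@fib_cast F (rep B) _ _
          (rho_comp (rho F L m z) (level_gt0 B) (hlevel_gt0 f) (hlevel_tgt f)
            (dvdn_lcml _ (hlevel g)))
          (hom_map (hrep f) t))).
    have KE t : hom_map (hom_at d1) (w t) = K (castA (w t)) by [].
    by rewrite !KE !wK /K uv.
  rewrite !E => H.
  exact (@fib_cast_inj (rep A) _ _ _ _ _ (@fib_cast_inj (rep A) _ _ _ _ _ H)).
have fI : injective (hom_map (hrep f) (x := rho F L' (hlevel f) x)).
  by rewrite -xE.
move=> u v /= uv.
exact: (@fib_cast_inj (rep A) _ _ _ _ _ (fI _ _ (@fib_cast_inj (rep B) _ _ _ _ _ uv))).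
Qed.


Lemma splits_unique A B q q' : proalg_iso A B -> splits A q -> splits B q' ->
  perm_eq q q'.
Proof.
move=> [f [g [fg gf]]] [sq [L [L0 AL Aq]]] [sq' [L' [L'0 BL' Bq']]].
have [Lf [Lf0 fLf If]] := hom_at_inj fg.
have [Lg [Lg0 gLg Ig]] := hom_at_inj gf.
pose N := (L * L' * (Lf * Lg))%N.
have N0 : (0 < N)%N by rewrite !muln_gt0 L0 L'0 Lf0 Lg0.
have LN : (L %| N)%N by rewrite /N -mulnA dvdn_mulr.
have L'N : (L' %| N)%N by rewrite /N mulnC mulnA dvdn_mull.
have LfN : (Lf %| N)%N by rewrite /N mulnA dvdn_mulr // dvdn_mull.
have LgN : (Lg %| N)%N by rewrite /N mulnA dvdn_mull.
have [k [s [kE fs]]] := splits_at_dvd L0 N0 AL LN Aq.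
have [l [t [lE ft]]] := splits_at_dvd L'0 N0 BL' L'N Bq'.
have [P [fP PE]] := hom_coef_matrix fs ft (If N (dvdn_trans fLf LfN) None N0 LfN).
have [Q [fQ QE]] := hom_coef_matrix ft fs (Ig N (dvdn_trans gLg LgN) None N0 LgN).
have NQ : 0 < N%:Q by rewrite ltr0z.
apply: (perm_eq_of_matrices sq sq' fP fQ).
- by move=> i j /PE; rewrite -(ler_int rat) kE lE ler_pM2r.
- by move=> i j /QE; rewrite -(ler_int rat) kE lE ler_pM2r.
Qed.

(** The representatives are compared at the level of the composite, where the
    identifications of fibres cancel in pairs. *)
Lemma hom_eq_id_of_inverse A B (L : nat) (L0 : (0 < L)%N)
  (AL : (level A %| L)%N) (BL : (level B %| L)%N)
  (h : bundle_hom (rep_at A L) (rep_at B L)) (h' : bundle_hom (rep_at B L) (rep_at A L)) :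
  (forall x v, hom_map h' (hom_map h (x := x) v) = v) ->
  proalg_hom_eq
    (proalg_comp (ProalgHom L0 AL BL h) (ProalgHom L0 BL AL h')) (proalg_id A).
Proof.
move=> hK; set f := ProalgHom _ _ _ h; set g := ProalgHom _ _ _ h'.
exists (hlevel (proalg_comp f g)), (hlevel_gt0 (proalg_comp f g)), (dvdnn _).
exists (hlevel_src (proalg_comp f g)) => x v /=.
rewrite [X in hom_map h' X](@fib_castK _ (rep B)) hK.
rewrite [X in fib_cast _ X = _](@fib_castK _ (rep A)) [LHS](@fib_castK _ (rep A)).
by rewrite [RHS](@fib_castK _ (rep A)).
Qed.

Lemma iso_of_splits A B q : splits A q -> splits B q -> proalg_iso A B.
Proof.
move=> [sqA [L [L0 AL Aq]]] [sqB [L' [L'0 BL' Bq]]].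
pose N := lcmn L L'.
have N0 : (0 < N)%N by rewrite lcmn_gt0 L0.
have LN : (L %| N)%N by exact: dvdn_lcml.
have L'N : (L' %| N)%N by exact: dvdn_lcmr.
have [k [s [kE fs]]] := splits_at_dvd L0 N0 AL LN Aq.
have [l [t [lE ft]]] := splits_at_dvd L'0 N0 BL' L'N Bq.
have rAB : rank (rep_at A N) = rank (rep_at B N) by rewrite -[LHS]sqA -[RHS]sqB.
have kl r : k r = l (cast_ord rAB r).
  by apply: (@intr_inj rat); rewrite kE lE.
have lk r : l r = k (cast_ord (esym rAB) r) by rewrite kl cast_ordKV.
have [|h hE] := @hom_of_sections _ _ _ _ s (fun r => t (cast_ord rAB r)) fs.
  by move=> r; rewrite kl; exact: (frame_wsec ft).
have [|h' h'E] := @hom_of_sections _ _ _ _ t (fun r => s (cast_ord (esym rAB) r)) ft.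
  by move=> r; rewrite lk; exact: (frame_wsec fs).
exists (ProalgHom N0 (dvdn_trans AL LN) (dvdn_trans BL' L'N) h).
exists (ProalgHom N0 (dvdn_trans BL' L'N) (dvdn_trans AL LN) h').
split; apply: hom_eq_id_of_inverse => x v.
- have [coef [_ coefK _]] := frame_coef fs.
  rewrite [in LHS](coefK x v).
  rewrite (lin_sum (@hom_linear _ _ _ h x)) (lin_sum (@hom_linear _ _ _ h' x)).
  rewrite [RHS](coefK x v); apply: eq_bigr => r _.
  rewrite (linZ (@hom_linear _ _ _ h x)) (linZ (@hom_linear _ _ _ h' x)).
  by rewrite hE h'E cast_ordK.
- have [coef [_ coefK _]] := frame_coef ft.
  rewrite [in LHS](coefK x v).
  rewrite (lin_sum (@hom_linear _ _ _ h' x)) (lin_sum (@hom_linear _ _ _ h x)).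
  rewrite [RHS](coefK x v); apply: eq_bigr => r _.
  rewrite (linZ (@hom_linear _ _ _ h' x)) (linZ (@hom_linear _ _ _ h x)).
  by rewrite h'E hE cast_ordKV.
Qed.

End Proalgebraic.

Theorem theorem10 (R : realType) (n : nat) (E : proalg (complex R))
    (E_rank : proalg_rank E = n) :
  (exists q : n.-tuple rat,
     proalg_iso E
       (\big[@proalg_sum _/@proalg0 _]_(i < n) line_proalg _ (tnth q i))) /\
  (forall q q' : n.-tuple rat,
     proalg_iso E
       (\big[@proalg_sum _/@proalg0 _]_(i < n) line_proalg _ (tnth q i)) ->
     proalg_iso E
       (\big[@proalg_sum _/@proalg0 _]_(i < n) line_proalg _ (tnth q' i)) ->
     perm_eq q q').
Proof.
split.
  have [q Eq] := exists_splits E.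
  have sq : size q == n by rewrite Eq.1 E_rank.
  exists (Tuple sq); rewrite -(big_tuple _ _ (Tuple sq) xpredT (@line_proalg _)).
  exact (iso_of_splits Eq (splits_big_sum _ q)).
move=> q q'; rewrite -!(big_tuple _ _ _ xpredT (@line_proalg _)) => Eq Eq'.
have [q0 E0] := exists_splits E.
have p := splits_unique Eq E0 (splits_big_sum _ q).
have p' := splits_unique Eq' E0 (splits_big_sum _ q').
by rewrite -(permPl p).
Qed.
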